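(* Let $p>1$ and let $\Omega\subset\mathbb{R}^d$, $d\ge2$, be a bounded Lipschitz domain. Let $K\subset K_1\cup K_2$ be any set such that $K_1\cup K_2\subset\Omega$, where $K_1,K_2$ are compact sets of codimension $k_1,k_2$ respectively, of class $C^{0,1}$, with $k_1<k_2$ and $k_1,k_2\in\{2,\dots,d-1\}$. Let $s\in(0,1)$ and $sp=\gamma$, where $\gamma=\theta k_1+(1-\theta)k_2$ for some $\theta\in(0,1)$, and $s=\theta s_1+(1-\theta)s_2$ for some $s_1,s_2\in(0,1)$ with $s_1p=k_1$ and $s_2p=k_2$. Assume that $\max\{\delta_{K_1}(x),\delta_{K_2}(x)\}<R$ for all $x\in\Omega$, for some $R>0$. Assume also that there is a constant $c>0$ such that, in a small neighbourhood of $K_1\cup K_2$, $$\delta_K^\gamma(x)\ln^p\!\left(\frac{2R}{\delta_K(x)}\right)\ge c\,\delta_{K_1}^{\theta k_1}(x)\ln^{\theta p}\!\left(\frac{2R}{\delta_{K_1}(x)}\right)\delta_{K_2}^{(1-\theta)k_2}(x)\ln^{(1-\theta)p}\!\left(\frac{2R}{\delta_{K_2}(x)}\right).$$ Then there exists a constant $C>0$ such that $$\left(\int_\Omega\frac{|u(x)|^p}{\delta_K^\gamma(x)\ln^p\!\left(\frac{2R}{\delta_K(x)}\right)}\,dx\right)^{\frac1p}\le C\,\|u\|^{\theta}_{W^{s_1,p}(\Omega)}\,\|u\|^{1-\theta}_{W^{s_2,p}(\Omega)}\quad\text{for all }u\in W_0^{s_1,p}(\Omega\setminus K_1)\cap W_0^{s_2,p}(\Omega\setminus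 K_2).$$
   Context: Notation: for a set $A$, $\delta_A(x)=\inf_{y\in A}|x-y|$; $\ln^\beta(t)=(\ln t)^\beta$. For $\sigma\in(0,1)$: $[u]^p_{W^{\sigma,p}(\Omega)}=\int_\Omega\int_\Omega\frac{|u(x)-u(y)|^p}{|x-y|^{d+\sigma p}}\,dx\,dy$; $W^{\sigma,p}(\Omega)$ is the space of $u\in L^p(\Omega)$ with $[u]_{W^{\sigma,p}(\Omega)}<\infty$, with norm $\|u\|_{W^{\sigma,p}(\Omega)}=\left([u]^p_{W^{\sigma,p}(\Omega)}+\|u\|^p_{L^p(\Omega)}\right)^{1/p}$. For a compact $A\subset\Omega$, $W^{\sigma,p}_0(\Omega\setminus A)$ is the closure, with respect to $\|\cdot\|_{W^{\sigma,p}(\Omega)}$, of the set of $u\in W^{\sigma,p}(\Omega)\cap C(\Omega)$ that vanish in a neighbourhood of $A$. Class $C^{0,1}$ (for $1<k<d$): a compact surface $A$ of codimension $k$ in $\mathbb{R}^d$ is of class $C^{0,1}$ if there is $C>0$ such that for every $x\in A$ there exist a ball $B=B_r(x)\subset\mathbb{R}^d$, $r>0$, and an isomorphism $T:Q\to B$, with $Q=B_1^k(0)\times(0,1)^{d-k}$ and $B_1^k(0)$ the unit ball of $\mathbb{R}^k$ centered at $0$, such that $T\in C^{0,1}(\overline Q)$, $T^{-1}\in C^{0,1}(\overline B)$ (Lipschitz), $\|T\|_{C^{0,1}(\overline Q)}+\|T^{-1}\|_{C^{0,1}(\overline B)}\le C$, and, writing $\xi=(\xi_k,\xi_{d-k})\in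 Q$ with $\xi_k\in B_1^k(0)$, $\xi_{d-k}\in(0,1)^{d-k}$, one has $T^{-1}(B\cap A)=\{\xi\in Q:\xi_k=0\}$. It is also assumed that for any $y=T((\xi_k,\xi_{d-k}))\in(\Omega\setminus A)\cap B$ one has $C_1|\xi_k|\le\delta_A(y)\le C_2|\xi_k|$ for some $C_1,C_2>0$ very close to $1$.
   Formalization: The formal statement also assumes that the supremum of δ_K over Ω is less than 2R; without it ln(2R/δ_K) can vanish or be negative in Ω and the left-hand integral can be infinite, so the claim fails. *)

(* Defs.v *)
From HB Require Import structures.
From mathcomp Require Import all_boot all_order all_algebra.
From mathcomp Require Import all_classical all_reals all_analysis.

Set Implicit Arguments.
Unset Strict Implicit.
Unset Printing Implicit Defensive.

Import Order.TTheory GRing.Theory Num.Theory.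
Import numFieldNormedType.Exports.

Local Open Scope classical_set_scope.
Local Open Scope ring_scope.

(* R^n is ['rV[R]_n] with its library topology (that of the sup norm, hence
   the usual one).  It carries the sigma-algebra generated by the
   coordinates, i.e. the product = Borel sigma-algebra, exactly as the library
   does for [n.-tuple]. *)
Definition measure_rV_display : measure_display. Proof. exact. Qed.

Section measurable_rV.
Variables (R : realType) (n : nat).

Let coord (i : 'I_n) (x : 'rV[R]_n) : measurableTypeR R := x 0 i.

Let rV_set0 : g_sigma_preimage coord set0.
Proof. exact: sigma_algebra0. Qed.

Let rV_setC A : g_sigma_preimage coord A -> g_sigma_preimage coord (~` A).
Proof. exact: sigma_algebraC. Qed.

Let rV_bigcup (F : (set 'rV[R]_n)^nat) :
  (forall i, g_sigma_preimage coord (F i)) ->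
  g_sigma_preimage coord (\bigcup_i (F i)).
Proof. exact: sigma_algebra_bigcup. Qed.

HB.instance Definition _ := @isMeasurable.Build measure_rV_display
  'rV[R]_n (g_sigma_preimage coord) rV_set0 rV_setC rV_bigcup.

Lemma measurable_rV_coord (i : 'I_n) :
  measurable_fun [set: 'rV[R]_n] (fun x => x 0 i : measurableTypeR R).
Proof.
move=> _ Y mY; rewrite setTI; apply: sub_sigma_algebra => /=.
rewrite -bigcup_seq/=; exists i => /=; first by rewrite mem_index_enum.
by exists Y => //; rewrite setTI.
Qed.

Lemma measurable_fun_rVP d (T : measurableType d) (f : T -> 'rV[R]_n) :
  (forall i, measurable_fun [set: T] (fun t => f t 0 i : measurableTypeR R)) ->
  measurable_fun [set: T] f.
Proof.
move=> mf _ A mA; rewrite setTI.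
suff : g_sigma_preimage coord `<=` image_set_system setT f measurable.
  by move=> /(_ _ mA); rewrite /image_set_system/= setTI.
apply: smallest_sub.
  exact/sigma_algebra_image/sigma_algebra_measurable.
rewrite -bigcup_seq => B [i _] [Y mY <-].
by rewrite /image_set_system/= !setTI -[X in measurable X]setTI; exact: mf.
Qed.

End measurable_rV.

Definition rV_cons (R : realType) n (xy : measurableTypeR R * 'rV[R]_n) :
  'rV[R]_n.+1 := \row_i (if unlift ord0 i is Some j then xy.2 0 j else xy.1).

Lemma measurable_rV_cons (R : realType) n :
  measurable_fun [set: measurableTypeR R * 'rV[R]_n] (@rV_cons R n).
Proof.
apply: measurable_fun_rVP => i.
under eq_fun do rewrite mxE.
case: unliftP => [j|] _; last exact: measurable_fst.
exact: (measurableT_comp (measurable_rV_coord j) measurable_snd).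
Qed.

(* [rV_cons] identifies R * R^n with R^(n+1): Lebesgue measure on R^(n+1) is
   the image of the product of the Lebesgue measures on R and R^n. *)
Section lebesgue_cons.
Variables (R : realType) (n : nat).
Variable mu : {sigma_finite_measure set 'rV[R]_n -> \bar R}.

Definition lebesgue_cons : set 'rV[R]_n.+1 -> \bar R :=
  pushforward (@lebesgue_measure R \x mu)%E (@rV_cons R n).

Let lebesgue_cons0 : lebesgue_cons set0 = 0%E.
Proof. by rewrite /lebesgue_cons /pushforward preimage_set0 measure0. Qed.

Let mcons A : measurable A -> measurable (@rV_cons R n @^-1` A).
Proof.
by move=> mA; rewrite -[X in measurable X]setTI; exact: measurable_rV_cons.
Qed.

Let lebesgue_cons_ge0 A : (0 <= lebesgue_cons A)%E.
Proof. by rewrite /lebesgue_cons /pushforward measure_ge0. Qed.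

Let lebesgue_cons_sigma_additive : semi_sigma_additive lebesgue_cons.
Proof.
move=> F mF tF mUF; rewrite /lebesgue_cons /pushforward preimage_bigcup.
apply: measure_semi_sigma_additive.
- by move=> k; exact: mcons.
- apply/trivIsetP => /= i j _ _ ij; rewrite -preimage_setI.
  by move/trivIsetP : tF => /(_ _ _ _ _ ij) ->//; rewrite preimage_set0.
- by rewrite -preimage_bigcup; exact: mcons.
Qed.

HB.instance Definition _ := isMeasure.Build _ _ _ lebesgue_cons
  lebesgue_cons0 lebesgue_cons_ge0 lebesgue_cons_sigma_additive.

Let lebesgue_cons_sigma_finite : sigma_finite setT lebesgue_cons.
Proof.
pose h (x : 'rV[R]_n.+1) : measurableTypeR R * 'rV[R]_n :=
  (x 0 ord0, \row_j x 0 (lift ord0 j)).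
have mh : measurable_fun setT h.
  apply/measurable_fun_pair; first exact: measurable_rV_coord.
  apply: measurable_fun_rVP => i.
  by under eq_fun do rewrite mxE; exact: measurable_rV_coord.
have hK : cancel (@rV_cons R n) h.
  move=> [a x]; congr pair; first by rewrite mxE unlift_none.
  by apply/rowP => j; rewrite !mxE liftK.
have /sigma_finiteP[F [TF ndF Foo]] : sigma_finite setT (@lebesgue_measure R).
  exact: sigma_finiteT.
have /sigma_finiteP[G [TG ndG Goo]] := sigma_finiteT mu.
have mFG k : measurable (F k `*` G k).
  by apply: measurableX; [exact: (Foo k).1|exact: (Goo k).1].
exists (fun k => h @^-1` (F k `*` G k)) => [|k].
  apply/esym; rewrite -subTset => x _.
  have [i _ Fix] : (\bigcup_i F i) (h x).1 by rewrite -TF.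
  have [j _ Gjx] : (\bigcup_j G j) (h x).2 by rewrite -TG.
  exists (maxn i j) => //; split.
  - by move: Fix; exact/subsetPset/ndF/leq_maxl.
  - by move: Gjx; exact/subsetPset/ndG/leq_maxr.
split; first by rewrite -[X in measurable X]setTI; exact: mh.
rewrite /lebesgue_cons /pushforward -comp_preimage.
rewrite (_ : h \o _ = id); last exact/funext/hK.
have [? ?] := Foo k; have [? ?] := Goo k.
by rewrite preimage_id product_measure1E// lte_mul_pinfty// ge0_fin_numE.
Qed.

HB.instance Definition _ := Measure_isSigmaFinite.Build _ _ _ lebesgue_cons
  lebesgue_cons_sigma_finite.

End lebesgue_cons.

Fixpoint lebesgue_rV (R : realType) n :
    {sigma_finite_measure set 'rV[R]_n -> \bar R} :=
  match n with
  | 0%N => \d_ (0 : 'rV[R]_0)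
  | m.+1 => lebesgue_cons (lebesgue_rV R m)
  end.

Lemma lebesgue_rV_box (R : realType) n (A : 'I_n -> set (measurableTypeR R)) :
  (forall i, measurable (A i)) ->
  lebesgue_rV R n [set x | forall i, A i (x 0 i)] =
  (\prod_(i < n) lebesgue_measure (A i))%E.
Proof.
elim: n A => [|n IHn] A mA.
  by rewrite big_ord0 /= diracE mem_set// => -[].
rewrite big_ord_recl -IHn; last by move=> i; exact: mA.
rewrite /= /lebesgue_cons /pushforward -product_measure1E//; last first.
  rewrite (_ : (fun _ => _) = \bigcap_(i in [set: 'I_n])
      ((fun x : 'rV[R]_n => x 0 i : measurableTypeR R) @^-1` A (lift ord0 i))).
    apply: fin_bigcap_measurable => // i _.
    by rewrite -[X in measurable X]setTI; exact: measurable_rV_coord.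
  by apply/seteqP; split=> x Ax i => [_|]; [exact: (Ax i)|exact: (Ax i I)].
congr product_measure1; apply/seteqP; split=> -[a x] /=.
  move=> Aax; split=> [|i].
    by have := Aax ord0; rewrite mxE unlift_none.
  by have := Aax (lift ord0 i); rewrite mxE liftK.
move=> [Aa Ax] i; rewrite mxE.
case: unliftP => [j ->|->]; [exact: Ax|exact: Aa].
Qed.

Section euclidean.
Variable R : realType.

(* The library norm of ['rV[R]_n] is the sup norm. *)
Definition enorm n (x : 'rV[R]_n) : R := Num.sqrt (\sum_i x 0 i ^+ 2).

Definition eball n (x : 'rV[R]_n) (r : R) : set 'rV[R]_n :=
  [set y | enorm (y - x) < r].

(* [inf set0 = 0], so this is the distance to [A] only for nonempty [A]. *)
Definition delta n (A : set 'rV[R]_n) (x : 'rV[R]_n) : R :=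
  inf [set enorm (x - y) | y in A].

Definition C01_norm m n (D : set 'rV[R]_m) (f : 'rV[R]_m -> 'rV[R]_n) : \bar R :=
  (ereal_sup [set (enorm (f x))%:E | x in D] +
   ereal_sup [set (enorm (f x - f y) / enorm (x - y))%:E | x in D & y in D])%E.

(* Locally, up to a rotation or reflection [O], [Omega] is the strict epigraph
   of a Lipschitz function of the coordinates other than the [j]-th. *)
Definition lipschitz_boundary d (Omega : set 'rV[R]_d) : Prop :=
  forall x, (closure Omega `\` interior Omega) x ->
  exists (r L : R) (O : 'M[R]_d) (j : 'I_d) (phi : 'rV[R]_d.-1 -> R),
    [/\ 0 < r, O *m O^T = 1%:M,
        forall a b, `|phi a - phi b| <= L * enorm (a - b) &
        Omega `&` eball x r =
        [set y | eball x r y /\ phi (col' j (y *m O)) < (y *m O) 0 j]].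

Definition bounded_lipschitz_domain d (Omega : set 'rV[R]_d) : Prop :=
  [/\ Omega !=set0, open Omega, connected Omega, bounded_set Omega &
      lipschitz_boundary Omega].

(* |xi_k|, where [xi = (xi_k, xi_{d-k})] splits off the first [k] coordinates. *)
Definition normk d (k : nat) (xi : 'rV[R]_d) : R :=
  Num.sqrt (\sum_(i < d | (i < k)%N) xi 0 i ^+ 2).

Definition cylinder d (k : nat) : set 'rV[R]_d :=
  [set xi | normk k xi < 1 /\
            forall i : 'I_d, (k <= i)%N -> 0 < xi 0 i /\ xi 0 i < 1].

(* [T] maps the cylinder onto a ball around [x], [S] is its inverse; both are
   total functions, so that their values on the closures are the continuous
   extensions. *)
Definition C01_surface d (Omega : set 'rV[R]_d) (k : nat) (A : set 'rV[R]_d)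
    : Prop :=
  [/\ compact A, A !=set0 &
   exists2 C : R, 0 < C &
   forall x, A x ->
   exists (r : R) (T S : 'rV[R]_d -> 'rV[R]_d),
    [/\ 0 < r,
        set_bij (cylinder k) (eball x r) T /\
          (forall xi, cylinder k xi -> S (T xi) = xi),
        (C01_norm (closure (cylinder k)) T +
         C01_norm (closure (eball x r)) S <= C%:E)%E,
        S @` (eball x r `&` A) =
          [set xi | cylinder k xi /\
                    forall i : 'I_d, (i < k)%N -> xi 0 i = 0] &
        exists C1 C2 : R, [/\ 0 < C1, 0 < C2 &
          forall xi, cylinder k xi -> (Omega `\` A) (T xi) ->
          C1 * normk k xi <= delta A (T xi) /\
          delta A (T xi) <= C2 * normk k xi]]].

(* Members of L^p and W^{sigma,p} are Borel representatives
   [u : 'rV[R]_d -> R]; only their values on [Omega] matter. *)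

Definition Lp_pow d (Omega : set 'rV[R]_d) (p : R) (u : 'rV[R]_d -> R)
    : \bar R :=
  (\int[lebesgue_rV R d]_(x in Omega) (`|u x| `^ p)%:E)%E.

Definition gagliardo_pow d (Omega : set 'rV[R]_d) (sigma p : R)
    (u : 'rV[R]_d -> R) : \bar R :=
  (\int[lebesgue_rV R d]_(x in Omega) \int[lebesgue_rV R d]_(y in Omega)
    (`|u x - u y| `^ p / enorm (x - y) `^ (d%:R + sigma * p))%:E)%E.

Definition W_norm d (Omega : set 'rV[R]_d) (sigma p : R) (u : 'rV[R]_d -> R)
    : \bar R :=
  ((gagliardo_pow Omega sigma p u + Lp_pow Omega p u) `^ p^-1)%E.

Definition W d (Omega : set 'rV[R]_d) (sigma p : R) : set ('rV[R]_d -> R) :=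
  [set u | [/\ measurable_fun Omega u, (Lp_pow Omega p u < +oo)%E &
               (gagliardo_pow Omega sigma p u < +oo)%E]].

Definition vanishes_near d (Omega A : set 'rV[R]_d) (u : 'rV[R]_d -> R) : Prop :=
  exists U : set 'rV[R]_d,
    [/\ open U, A `<=` U & forall x, (U `&` Omega) x -> u x = 0].

Definition W0 d (Omega A : set 'rV[R]_d) (sigma p : R) : set ('rV[R]_d -> R) :=
  [set u | W Omega sigma p u /\
    forall e : R, 0 < e -> exists v : 'rV[R]_d -> R,
      [/\ W Omega sigma p v, {within Omega, continuous v},
          vanishes_near Omega A v &
          (W_norm Omega sigma p (u \- v)%R < e%:E)%E]].

(* Meaningful for [0 < delta A x < 2 * rho]: a negative base of [`^] gives the
   junk value 1.  At [delta A x = 0] the value is 0, for [a != 0]. *)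
Definition log_weight d (rho a b : R) (A : set 'rV[R]_d) (x : 'rV[R]_d) : R :=
  delta A x `^ a * ln (2 * rho / delta A x) `^ b.

End euclidean.

(* Main.v *)
(* Hoelder's inequality with exponents [1 / theta] and [1 / (1 - theta)] reduces
   the claim to the critical Hardy inequalities, for [s p = k],
     int_Omega |u|^p / (delta_K^k ln^p (2 rho / delta_K)) <= C ||u||_{W^{s,p}}^p
   for [K = K1] and [K = K2]; away from a neighbourhood of [K1 `|` K2] all the
   weights are comparable to constants.

   A surface of codimension [k] satisfies
     |{delta_K < r} `&` Q(y, rho)| <= C rho^(d - k) r^k   (r <= rho),
   so that it is porous: for every [x] and every scale [rho_i = rho_0 lam^i], a
   fixed proportion of the cube [Q(x, rho_i)] consists of points [y] with
   [delta_K y >= beta rho_i]. If [delta_K x ~ rho_j], the value [u x] is compared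
   to the averages over these porous cubes, for i = j, j - 1, ..., 0. Jumping
   from one scale to the next costs the Gagliardo energy density on the shell
   {delta_K ~ rho_i}, and weighting the i-th jump by a power of [i] (Hardy's
   inequality in the variable i ~ ln (1 / delta_K)) produces exactly the factor
   ln^p. The measure bound above turns the sum over x of the costs into a sum of
   energies over the disjoint shells. *)
Require Import Defs.
From mathcomp Require Import all_boot all_order all_algebra.
From mathcomp Require Import all_classical all_reals all_analysis.
From mathcomp Require Import measurable_realfun ring lra.

Set Implicit Arguments.
Unset Strict Implicit.
Unset Printing Implicit Defensive.

Import Order.TTheory GRing.Theory Num.Theory.
Import numFieldNormedType.Exports.
Local Open Scope classical_set_scope.
Local Open Scope ring_scope.

(** * The Euclidean norm and the distance function *)

(** When [s p = k] the powers of the scales cancel: a jump at scale i costs about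
    [scale i ^ (k - d)] times the energy in a porous cube, and integrating this over the layer j
    gives [scale i ^ (d - k) * scale j ^ k]. After division by the weight all scales count alike and
    nothing decays geometrically; convergence must come from powers of the layer index alone. Write
    [p = 1 + 2 q]. Splitting [(a + b) ^ p] by convexity at each jump, with first coefficients whose
    product telescopes, lets the main term grow only like [j ^ q], while the jump at i costs a
    further [i ^ q]. Since [j ^ (- p) * j ^ q = j ^ (- 1 - q)] has tails of order [i ^ (- q)], the
    two losses cancel. Any growth exponent strictly between 0 and [p - 1] would serve; the midpoint
    q makes the two losses equal. The interpolation meets the convention [x / 0 = 0]: where
    [delta K1] or [delta K2] vanishes, the corresponding Hardy quotient reads 0 and no longer
    dominates anything. That set is null, by the same measure bound that gives porosity, and is
    removed. *)

Section euclidean_norm.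
Context {R : realType} {n : nat}.
Implicit Types (x y z : 'rV[R]_n) (A : set 'rV[R]_n).

Lemma enorm_ge0 x : 0 <= enorm x.
Proof. exact: sqrtr_ge0. Qed.

Lemma enorm_sqr x : enorm x ^+ 2 = \sum_i x 0 i ^+ 2.
Proof. by rewrite sqr_sqrtr// sumr_ge0// => i _; exact: sqr_ge0. Qed.

Lemma enorm0 : enorm (0 : 'rV[R]_n) = 0.
Proof. by rewrite /enorm big1 ?sqrtr0// => i _; rewrite mxE expr0n. Qed.

Lemma enormN x : enorm (- x) = enorm x.
Proof.
by rewrite /enorm; under eq_bigr do rewrite mxE sqrrN.
Qed.

Lemma enorm_distC x y : enorm (x - y) = enorm (y - x).
Proof. by rewrite -enormN opprB. Qed.

Lemma enorm_eq0 x : enorm x = 0 -> x = 0.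
Proof.
move=> x0; apply/rowP => i; rewrite mxE; apply/eqP.
have : \sum_i x 0 i ^+ 2 = 0 by rewrite -enorm_sqr x0 expr0n.
move/eqP; rewrite psumr_eq0 => [/allP/(_ i)|j _]; last exact: sqr_ge0.
by rewrite mem_index_enum sqrf_eq0 => /(_ isT).
Qed.

Lemma enorm_coord x i : `|x 0 i| <= enorm x.
Proof.
rewrite -ler_sqr ?nnegrE ?enorm_ge0// enorm_sqr real_normK ?num_real//.
by rewrite (bigD1 i)//= lerDl sumr_ge0// => j _; exact: sqr_ge0.
Qed.

(** A factor cruder than the square root of n. It is the origin of the factors [d%:R] in the
    constants of the chain and of the covering. *)
Lemma enorm_le_coord x M : 0 <= M -> (forall i, `|x 0 i| <= M) ->
  enorm x <= n%:R * M.
Proof.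
move=> M0 xM; rewrite -ler_sqr ?nnegrE ?enorm_ge0 ?mulr_ge0//.
rewrite enorm_sqr (@le_trans _ _ (\sum_(i < n) M ^+ 2))//.
  by apply: ler_sum => i _; rewrite -real_normK ?num_real// ler_sqr ?nnegrE.
rewrite sumr_const card_ord exprMn -[leLHS]mulr_natl ler_wpM2r ?sqr_ge0//.
by rewrite -natrX ler_nat; case: (n) => // m; rewrite expnS expn1 leq_pmulr.
Qed.

(** Young's inequality [(a + b)^2 <= (1 + t) a^2 + (1 + 1/t) b^2] in each coordinate, with the same
    [t] throughout. For [t = enorm y / enorm x] the right-hand sides add up to exactly the square of
    [enorm x + enorm y]. *)
Lemma ler_enormD x y : enorm (x + y) <= enorm x + enorm y.
Proof.
have [x0|x0] := eqVneq (enorm x) 0.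
  by rewrite x0 (enorm_eq0 x0) !add0r.
have [y0|y0] := eqVneq (enorm y) 0.
  by rewrite y0 (enorm_eq0 y0) !addr0.
have {}x0 : 0 < enorm x by rewrite lt_neqAle eq_sym x0 enorm_ge0.
have {}y0 : 0 < enorm y by rewrite lt_neqAle eq_sym y0 enorm_ge0.
rewrite -ler_sqr ?nnegrE ?enorm_ge0 ?addr_ge0 ?enorm_ge0//.
pose t := enorm y / enorm x.
have t0 : 0 < t by rewrite divr_gt0.
have -> : (enorm x + enorm y) ^+ 2 =
    \sum_i ((1 + t) * x 0 i ^+ 2 + (1 + t^-1) * y 0 i ^+ 2).
  rewrite big_split/= -!mulr_sumr -!enorm_sqr /t; field.
  by rewrite !gt_eqF.
rewrite enorm_sqr; apply: ler_sum => i _; rewrite mxE.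
rewrite -subr_ge0 (_ : _ - _ = t * (x 0 i - y 0 i / t) ^+ 2).
  by rewrite mulr_ge0 ?sqr_ge0 ?ltW.
by field; rewrite gt_eqF.
Qed.

Lemma ler_edistD x y z : enorm (x - z) <= enorm (x - y) + enorm (y - z).
Proof. by rewrite (le_trans _ (ler_enormD _ _))// addrA subrK. Qed.

End euclidean_norm.

Section distance_function.
Context {R : realType} {n : nat}.
Implicit Types (x y z : 'rV[R]_n) (A : set 'rV[R]_n).

Let dist_lb A x : lbound [set enorm (x - y) | y in A] 0.
Proof. by move=> _ [y _ <-]; exact: enorm_ge0. Qed.

Lemma delta_ge0 A x : 0 <= delta A x.
Proof.
have [->|A0] := eqVneq A set0; first by rewrite /delta image_set0 inf0.
apply: lb_le_inf; last exact: dist_lb.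
by case/set0P : A0 => y Ay; exists (enorm (x - y)), y.
Qed.

Lemma delta_le A x y : A y -> delta A x <= enorm (x - y).
Proof. by move=> Ay; apply: ge_inf; [exists 0; exact: dist_lb|exists y]. Qed.

Lemma delta_lt A x t : A !=set0 -> delta A x < t ->
  exists2 y, A y & enorm (x - y) < t.
Proof.
move=> [y Ay] /inf_lt[]; first by exists (enorm (x - y)), y.
by move=> _ [z Az <-]; exists z.
Qed.

Lemma le_delta A x t : A !=set0 -> (forall y, A y -> t <= enorm (x - y)) ->
  t <= delta A x.
Proof.
move=> [y Ay] At; apply: lb_le_inf; first by exists (enorm (x - y)), y.
by move=> _ [z Az <-]; exact: At.
Qed.

Lemma delta_lip A x y : A !=set0 -> delta A x <= enorm (x - y) + delta A y.
Proof.
move=> A0; rewrite -lerBlDl; apply: le_delta => // z Az.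
by rewrite lerBlDl (le_trans (delta_le x Az))// ler_edistD.
Qed.

End distance_function.

(** * Compactness: uniform radii and collars *)

Section topology.
Context {R : realType} {n : nat}.
Implicit Types (x y z : 'rV[R]_n) (A U : set 'rV[R]_n).

Lemma ball_rVP x e y : 0 < e -> ball x e y <-> forall i, `|x 0 i - y 0 i| < e.
Proof.
move=> e0; split=> [[_ xy] i|xy]; first exact: xy.
by split=> // i j; rewrite ord1; exact: xy.
Qed.

Lemma nbhs_eball x r : 0 < r -> nbhs x (eball x r).
Proof.
move=> r0; have e0 : 0 < r / n.+1%:R by rewrite divr_gt0.
apply/nbhs_ballP; exists (r / n.+1%:R) => //= y /ball_rVP xy.
rewrite /eball/= enorm_distC.
rewrite (@le_lt_trans _ _ (n%:R * (r / n.+1%:R)))//.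
  apply: enorm_le_coord => [|i]; first exact: ltW.
  by rewrite !mxE ltW// xy.
by rewrite mulrCA gtr_pMr// ltr_pdivrMr// mul1r ltr_nat.
Qed.

Lemma open_eballP U x : open U -> U x -> exists2 r, 0 < r & eball x r `<=` U.
Proof.
rewrite openE => /[apply]; rewrite /interior => /nbhs_ballP[/= e e0 eU].
exists e => // y xy; apply: eU; apply/ball_rVP => // i.
rewrite -normrN opprB; apply: le_lt_trans xy.
by have := enorm_coord (y - x) i; rewrite !mxE.
Qed.

(** Lebesgue's number lemma, from the near-covering form of compactness. A point [x] only takes half
    of its radius as neighbourhood, so that balls of radius below [r / 2] around the points there
    stay in [eball x r]. *)
Lemma compact_lebesgue_number A (P : 'rV[R]_n -> R -> Prop) : compact A ->
  (forall x, A x -> exists2 r, 0 < r & P x r) ->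
  exists2 e, 0 < e & forall y, A y ->
    exists x r, [/\ A x, P x r & eball y e `<=` eball x r].
Proof.
move=> /compact_near_coveringP cA PA.
pose Q e y := exists x r, [/\ A x, P x r & eball y e `<=` eball x r].
have : \forall e \near 0^'+, A `<=` Q e.
  apply: cA => x Ax; have [r r0 Pxr] := PA _ Ax.
  exists (eball x (r / 2), [set e | e < r / 2]).
    split; first by apply: nbhs_eball; rewrite divr_gt0.
    by apply: nbhs_right_lt; rewrite divr_gt0.
  move=> [y e] [/= xy er]; exists x, r; split => // z.
  rewrite /eball/= => yz; apply: (le_lt_trans (ler_edistD z y x)).
  by rewrite (splitr r) ltrD// (lt_trans yz).
move=> /(filterI (nbhs_right_gt 0)).
by move=> /filter_ex[e [e0 AQ]]; exists e.
Qed.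

Lemma compact_delta_open A U : compact A -> open U -> A !=set0 -> A `<=` U ->
  exists2 e, 0 < e & forall x, delta A x < e -> U x.
Proof.
move=> cA oU A0 AU.
have [|e e0 eA] := @compact_lebesgue_number A (fun x r => eball x r `<=` U) cA.
  by move=> x /AU; exact: open_eballP.
exists e => // x /(delta_lt A0)[y Ay xy].
by have [z [r [_ zU yz]]] := eA _ Ay; exact/zU/yz.
Qed.

End topology.

(** * Borel sets of row vectors and the measure of cubes *)

Section measurability.
Context {R : realType} {n : nat}.
Implicit Types (x y z : 'rV[R]_n) (A U : set 'rV[R]_n).

Definition cube x r : set 'rV[R]_n := [set y | forall i, `|y 0 i - x 0 i| < r].

Lemma cubeC x y r : cube x r y = cube y r x.
Proof.
by apply/propext; split=> xy i; rewrite -normrN opprB; exact: xy.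
Qed.

Let cube_box x r : cube x r =
  [set y | forall i, `]x 0 i - r, x 0 i + r[%classic (y 0 i)].
Proof.
by apply/funext => y; apply/propext; split=> xy i; have := xy i;
  rewrite /= in_itv/= ltr_distl.
Qed.

Lemma measurable_cube x r : measurable (cube x r).
Proof.
rewrite (_ : cube x r = \bigcap_(i in [set: 'I_n])
  ((fun y : 'rV[R]_n => y 0 i : measurableTypeR R) @^-1`
    `]x 0 i - r, x 0 i + r[%classic)); last first.
  by rewrite cube_box; apply/seteqP; split=> y xy i; [move=> _|]; exact: xy.
apply: fin_bigcap_measurable => // i _; rewrite -[X in measurable X]setTI.
by apply: measurable_rV_coord => //; exact: measurable_itv.
Qed.

Lemma measurable_cube_pair r :
  measurable [set xy : 'rV[R]_n * 'rV[R]_n | cube xy.1 r xy.2].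
Proof.
pose f (i : 'I_n) (xy : 'rV[R]_n * 'rV[R]_n) := `|xy.2 0 i - xy.1 0 i|.
have mf i : measurable_fun setT (f i).
  apply: measurableT_comp => //; apply: measurable_funB.
    exact: measurableT_comp (measurable_rV_coord i) measurable_snd.
  exact: measurableT_comp (measurable_rV_coord i) measurable_fst.
rewrite (_ : mkset _ =
    \bigcap_(i in [set: 'I_n]) (f i @^-1` [set` `]-oo, r[])); last first.
  apply/seteqP; split => -[x y] /=.
    by move=> xy i _; rewrite /= in_itv; exact: xy.
  by move=> xy i; have := xy i I; rewrite /= in_itv.
apply: fin_bigcap_measurable => // i _; rewrite -[X in measurable X]setTI.
exact: mf.
Qed.

Lemma lebesgue_cube x r : 0 <= r ->
  lebesgue_rV R n (cube x r) = ((2 * r) ^+ n)%:E.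
Proof.
move=> r0; rewrite cube_box.
have box := @lebesgue_rV_box R n
  (fun i => `]x 0 i - r, x 0 i + r[%classic) (fun i => measurable_itv _).
rewrite [LHS]box.
transitivity (\prod_(i < n) (2 * r)%:E)%E; last first.
  by rewrite prodEFin prodr_const card_ord.
apply: eq_bigr => i _.
rewrite lebesgue_measure_itv/= lte_fin ltrD2l -EFinB.
have -> : x 0 i + r - (x 0 i - r) = 2 * r by ring.
case: ifPn => //; rewrite -leNgt => rr; have -> : r = 0 by lra.
by rewrite mulr0.
Qed.

Lemma measurable_fun_lt d (T : measurableType d) (f : T -> R) :
  (forall t, measurable [set x | f x < t]) -> measurable_fun [set: T] f.
Proof.
move=> mf; apply: (measurability _ (RGenInftyO.measurableE R)) => //.
move=> _ [_ [t ->] <-]; rewrite setTI; have := mf t.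
by congr (measurable _); apply/seteqP; split=> x /=; rewrite in_itv.
Qed.

Lemma measurable_enorm d (T : measurableType d) (f : T -> 'rV[R]_n) :
  measurable_fun [set: T] f -> measurable_fun [set: T] (fun t => enorm (f t)).
Proof.
move=> mf.
apply: (@measurableT_comp _ _ _ _ _ _ (@Num.sqrt R) _
    (fun t => \sum_i f t 0 i ^+ 2)).
  by apply: continuous_measurable_fun; exact: sqrt_continuous.
apply: measurable_sum => i; apply: measurable_funX.
exact: (measurableT_comp (measurable_rV_coord i) mf).
Qed.

Lemma measurable_funB_rV d (T : measurableType d) (f g : T -> 'rV[R]_n) :
  measurable_fun [set: T] f -> measurable_fun [set: T] g ->
  measurable_fun [set: T] (fun t => f t - g t).
Proof.
move=> mf mg; apply: measurable_fun_rVP => i.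
under eq_fun do rewrite !mxE.
by apply: measurable_funB; exact: (measurableT_comp (measurable_rV_coord i)).
Qed.

(** The sigma-algebra is generated by coordinates, so an open set has to be a countable union of
    boxes: the cubes inside [U] with rational centre and radius [1 / (m + 1)]. *)
Lemma open_measurable_rV U : open U -> measurable U.
Proof.
move=> oU.
pose q (c : {ffun 'I_n -> rat}) : 'rV[R]_n := \row_i ratr (c i).
pose F (cm : {ffun 'I_n -> rat} * nat) : set 'rV[R]_n :=
  [set y | cube (q cm.1) cm.2.+1%:R^-1 y /\ cube (q cm.1) cm.2.+1%:R^-1 `<=` U].
have -> : U = \bigcup_cm F cm.
  apply/seteqP; split => [x Ux|x [cm _ [/[swap]]]]; last exact.
  have [r r0 rU] := open_eballP oU Ux.
  have [m mr] : exists m : nat, m.+1%:R^-1 < r / (2 * n.+1%:R).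
    have r'0 : 0 < r / (2 * n.+1%:R) by rewrite divr_gt0// mulr_gt0.
    have [m _ /(_ m (leqnn _))] := near_infty_natSinv_lt (PosNum r'0).
    by exists m.
  have xq i : {p : rat | `|x 0 i - ratr p| < m.+1%:R^-1}.
    apply: cid; have [|p] :=
        @rat_in_itvoo R (x 0 i - m.+1%:R^-1) (x 0 i + m.+1%:R^-1).
      by rewrite ltrD2l gtrN.
    by exists p; rewrite distrC ltr_distl.
  exists ([ffun i => sval (xq i)], m) => //; split => [i|y qy].
    by rewrite /= mxE ffunE; exact: svalP (xq i).
  apply: rU; rewrite /eball/=.
  rewrite (@le_lt_trans _ _ (n%:R * (r / n.+1%:R)))//.
    apply: enorm_le_coord => [|i]; first by rewrite divr_ge0// ltW.
    have := qy i; have := svalP (xq i); rewrite /= !mxE ffunE.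
    set p := ratr _ => xp yp.
    have -> : r / n.+1%:R = r / (2 * n.+1%:R) + r / (2 * n.+1%:R).
      by field; rewrite nat1r pnatr_eq0.
    rewrite ltW// (le_lt_trans (ler_distD p _ _))// ltrD// ?(lt_trans yp)//.
    by rewrite distrC (lt_trans xp).
  by rewrite mulrCA gtr_pMr// ltr_pdivrMr// mul1r ltr_nat.
apply: countable_bigcupT_measurable => // -[c m].
rewrite /F/=; have [cU|cU] := pselect (cube (q c) m.+1%:R^-1 `<=` U).
  rewrite (_ : mkset _ = cube (q c) m.+1%:R^-1); first exact: measurable_cube.
  by apply/seteqP; split=> y // -[].
rewrite (_ : mkset _ = set0); first exact: measurable0.
by apply/seteqP; split=> y // -[].
Qed.

Lemma open_delta_lt A t : A !=set0 -> open [set x | delta A x < t].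
Proof.
move=> A0; rewrite openE => x /=; rewrite -subr_gt0 => /(nbhs_eball x).
apply: filterS => y; rewrite /eball/= ltrBrDr; apply: le_lt_trans.
exact: delta_lip.
Qed.

Lemma measurable_delta A : A !=set0 -> measurable_fun [set: 'rV[R]_n] (delta A).
Proof.
move=> A0; apply: measurable_fun_lt => t.
by apply: open_measurable_rV; exact: open_delta_lt.
Qed.

End measurability.

(** * Regularity of surfaces of class C01 *)

Section C01_norm.
Context {R : realType}.

Lemma C01_norm_ge0 m n (D : set 'rV[R]_m) (f : 'rV[R]_m -> 'rV[R]_n) :
  D !=set0 -> (0 <= C01_norm D f)%E.
Proof.
move=> [x Dx]; apply: adde_ge0; apply: ereal_sup_ge.
  by exists (enorm (f x))%:E; [exists x|rewrite lee_fin enorm_ge0].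
exists (enorm (f x - f x) / enorm (x - x))%:E; first by exists x => //;
  exists x.
by rewrite subrr enorm0 mul0r.
Qed.

Lemma C01_norm_lip m n (D : set 'rV[R]_m) (f : 'rV[R]_m -> 'rV[R]_n) C x y :
  (C01_norm D f <= C%:E)%E -> D x -> D y ->
  enorm (f x - f y) <= C * enorm (x - y).
Proof.
move=> fC Dx Dy.
have [->|xy] := eqVneq x y; first by rewrite !subrr !enorm0 mulr0.
have xy0 : 0 < enorm (x - y).
  rewrite lt_neqAle enorm_ge0 andbT eq_sym; apply: contra xy => /eqP/enorm_eq0.
  by move/eqP; rewrite subr_eq0.
rewrite -ler_pdivrMr// -lee_fin; apply: le_trans fC.
rewrite -[leLHS]add0e; apply: leeD; apply: ereal_sup_ge.
  by exists (enorm (f x))%:E; [exists x|rewrite lee_fin enorm_ge0].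
exists (enorm (f x - f y) / enorm (x - y))%:E => //.
by exists x => //; exists y.
Qed.

End C01_norm.

Section regularity.
Context {R : realType} {d : nat}.
Implicit Types (x y z : 'rV[R]_d) (A K : set 'rV[R]_d).

Lemma lebesgue_cover_cubes (I : finType) (E : set 'rV[R]_d) (c : I -> 'rV[R]_d)
    (s : R) : 0 <= s -> measurable E -> E `<=` \bigcup_i cube (c i) s ->
  (lebesgue_rV R d E <= (#|I|%:R * (2 * s) ^+ d)%:E)%E.
Proof.
move=> s0 mE Ec.
apply: (@le_trans _ _ (\sum_(i : I) lebesgue_rV R d (cube (c i) s))%E).
  rewrite fsbig_seq ?index_enum_uniq//; apply: content_sub_fsum => //.
  - by move=> i _; exact: measurable_cube.
  - by move=> x /Ec[i _ xi]; exists i => //=; rewrite mem_index_enum.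
rewrite (eq_bigr (fun=> ((2 * s) ^+ d)%:E)) => [|i _]; last first.
  by rewrite lebesgue_cube.
by rewrite sumEFin sumr_const (@eq_card _ xpredT I)// (mulr_natl _ #|I|).
Qed.

(* The only property of a [C^{0,1}] surface that the Hardy inequality needs. *)
Definition codim_regular (k : nat) K (C r0 : R) :=
  forall y r rho, 0 < r -> r <= rho -> rho <= r0 ->
  (lebesgue_rV R d (cube y rho `&` [set x | (delta K x < r)%R]) <=
   (C * rho ^+ (d - k) * r ^+ k)%:E)%E.

Lemma C01_surface_flattening (Omega : set 'rV[R]_d) k K :
  C01_surface Omega k K ->
  exists2 C : R, 0 < C & forall x, K x -> exists2 r, 0 < r &
    exists S : 'rV[R]_d -> 'rV[R]_d,
    forall y z, (eball x r `&` K) y -> (eball x r `&` K) z ->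
    [/\ enorm (S y - S z) <= C * enorm (y - z),
        enorm (y - z) <= C * enorm (S y - S z) &
        forall i : 'I_d, (i < k)%N -> S y 0 i = 0].
Proof.
move=> [cK K0 [C C0 KC]]; exists C => // x Kx.
have [r [T [S [r0 [[_ _ surjT] ST] TSC SK _]]]] := KC x Kx.
exists r => //; exists S => y z [xry Ky] [xrz Kz].
have [a Ca Tay] := surjT _ xry.
have [b Cb Tbz] := surjT _ xrz.
(* The surface bounds only the sum of the two norms. Each is at most [C] because the other is
   nonnegative, and this takes a point of the domain: the supremum over the empty set is [-oo]. *)
have Tn0 : (0 <= C01_norm (closure (cylinder k)) T)%E.
  by apply: C01_norm_ge0; exists a; exact: subset_closure.
have Sn0 : (0 <= C01_norm (closure (eball x r)) S)%E.
  by apply: C01_norm_ge0; exists y; exact: subset_closure.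
have TC := le_trans (leeDl _ Sn0) TSC.
have SC := le_trans (leeDr _ Tn0) TSC.
split.
- by apply: C01_norm_lip SC _ _; exact: subset_closure.
- rewrite -Tay -Tbz !ST//.
  by apply: C01_norm_lip TC _ _; exact: subset_closure.
- have : (S @` (eball x r `&` K)) (S y) by exists y.
  by rewrite SK => -[].
Qed.

(* The inverse chart maps the part of [K] near [y] into a cube of side ~[rho] of
   the [(d - k)]-plane; a grid of mesh ~[r] there has ~[(rho / r) ^ (d - k)]
   cells, and the chart sends each cell into a ball of radius [r]. *)
Lemma C01_surface_regular (Omega : set 'rV[R]_d) k K : (k <= d)%N ->
  C01_surface Omega k K ->
  exists C r0, [/\ 0 < C, 0 < r0 & codim_regular k K C r0].
Proof.
move=> kd SK; have [cK K0 _] := SK.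
have [L L0 flat] := C01_surface_flattening SK.
pose P x r := exists S : 'rV[R]_d -> 'rV[R]_d,
    forall y z, (eball x r `&` K) y -> (eball x r `&` K) z ->
    [/\ enorm (S y - S z) <= L * enorm (y - z),
        enorm (y - z) <= L * enorm (S y - S z) &
        forall i : 'I_d, (i < k)%N -> S y 0 i = 0].
have [e e0 eP] := @compact_lebesgue_number R d K P cK flat.
(* If [x], [x0] lie in the cube and [w], [z] in [K] are [r]-close to them, then [w] and [z] are at
   distance below [r + 2 d rho + r <= b rho]. The bound [e / b] on [rho] then keeps all such [w] in
   one chart around [z]. *)
pose b : R := 2 + 2 * d%:R.
have b0 : 0 < b by rewrite /b ltr_wpDr// mulr_ge0.
pose B : R := 2 * (L * b) * (L * d%:R).
have B0 : 0 <= B by rewrite /B !mulr_ge0// ltW.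
exists ((B + 1) ^+ (d - k) * 4 ^+ d), (e / b); split.
- by rewrite mulr_gt0 ?exprn_gt0// ltr_wpDl.
- by rewrite divr_gt0.
move=> y r rho r0 rrho rhoe.
have rho0 : 0 < rho by exact: lt_le_trans rrho.
set E := _ `&` _.
have mE : measurable E.
  apply: measurableI; first exact: measurable_cube.
  by apply: open_measurable_rV; exact: open_delta_lt.
have [[x0 [yx0 /(delta_lt K0)[z Kz x0z]]]|/nonemptyPn E0] :=
  pselect (E !=set0); last first.
  by rewrite E0 measure0 lee_fin !mulr_ge0 ?exprn_ge0 ?addr_ge0// ltW.
have [x1 [r1 [_ [S SP] zx1]]] := eP _ Kz.
pose near x := K x /\ enorm (x - z) < b * rho.
have nearP x : near x -> (eball x1 r1 `&` K) x.
  move=> [Kx xz]; split => //; apply: zx1; rewrite /eball/=.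
  by rewrite (lt_le_trans xz)// mulrC -ler_pdivlMr.
have nearz : near z by split => //; rewrite subrr enorm0 mulr_gt0.
pose M := L * (b * rho).
have SM x i : near x -> `|S x 0 i - S z 0 i| <= M.
  move=> nx; have [Sxz _ _] := SP _ _ (nearP _ nx) (nearP _ nearz).
  have := enorm_coord (S x - S z) i; rewrite !mxE => /le_trans; apply.
  by apply: (le_trans Sxz); rewrite ler_pM2l//; case: nx => _ /ltW.
have sh_subproof (l : 'I_(d - k)) : (k + l < d)%N by rewrite -ltn_subRL.
pose sh l := Ordinal (sh_subproof l).
have dk0 : (0 < d%:R :> R) \/ d = 0%N.
  by rewrite ltr0n; case: (d) => [|m]; [right|left].
(* The mesh solves [L (d h) = r], so that points of [K] in one cell are [r]-close. The flattened
   piece of [K] lies in a cube of side [2 M], and [2 M / h = B rho / r] bounds the cell indices. *)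
pose h := r / (L * d%:R).
pose N := Num.truncn (B * rho / r).
pose cell x : {ffun 'I_(d - k) -> 'I_N.+1} :=
  [ffun l => inord (Num.truncn ((S x 0 (sh l) - S z 0 (sh l) + M) / h))].
have cell_close x x' : near x -> near x' -> cell x = cell x' ->
    enorm (x - x') <= r.
  move=> nx nx' /ffunP xx'.
  have [_ + Sx0] := SP _ _ (nearP _ nx) (nearP _ nx').
  have [_ _ Sx'0] := SP _ _ (nearP _ nx') (nearP _ nx).
  move=> /le_trans; apply; case: dk0 => [d0|d0]; last first.
    rewrite (_ : enorm _ = 0) ?mulr0 ?ltW//.
    apply/eqP; rewrite eq_le enorm_ge0 andbT.
    have := @enorm_le_coord R d (S x - S x') 0 (lexx _).
    by rewrite mulr0; apply => i; suff: False by []; move: (i);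
      rewrite d0 => -[].
  have h0 : 0 < h by rewrite divr_gt0// mulr_gt0.
  have -> : r = L * (d%:R * h).
    by rewrite /h; field; rewrite !gt_eqF.
  rewrite ler_pM2l//; apply: enorm_le_coord => [|i]; first exact: ltW.
  have [ik|ki] := ltnP i k.
    by rewrite !mxE Sx0// Sx'0// subrr normr0 ltW.
  have lk : (i - k < d - k)%N by rewrite ltn_sub2r// (leq_ltn_trans ki).
  have := xx' (Ordinal lk); rewrite !ffunE.
  have -> : sh (Ordinal lk) = i by apply: val_inj; rewrite /= subnKC.
  set t := (_ + M) / h; set t' := (_ + M) / h => tt'.
  have tN x2 : near x2 -> 0 <= (S x2 0 i - S z 0 i + M) / h /\
      (Num.truncn ((S x2 0 i - S z 0 i + M) / h)%R < N.+1)%N.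
    move=> /(SM _ i); rewrite ler_norml => /andP[SM1 SM2].
    have SM0 : 0 <= S x2 0 i - S z 0 i + M by rewrite -lerBlDr sub0r.
    split; first by rewrite divr_ge0// ltW.
    rewrite ltnS; apply: le_truncn.
    rewrite ler_pdivrMr// (@le_trans _ _ (M + M)) ?lerD2r//.
    rewrite le_eqVlt; apply/orP; left; apply/eqP.
    by rewrite /M /B /h; field; rewrite !gt_eqF.
  have [[t0 tlt] [t'0 t'lt]] := (tN _ nx, tN _ nx').
  move: tt' => /(congr1 val); rewrite /= !inordK// => tt'.
  have := truncn_itv t0; have := truncn_itv t'0.
  rewrite -/t -/t' tt' => /andP[t1 t2] /andP[t3 t4].
  have -> : (S x - S x') 0 i = (t - t') * h.
    by rewrite !mxE /t /t'; field; rewrite gt_eqF.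
  rewrite normrM (gtr0_norm h0) ler_piMl ?ltW// ltr_norml.
  by move: t1 t2 t3 t4; rewrite -[_.+1]addn1 natrD; lra.
(* One point of [K] for each occupied cell, and the dummy [z] for the others. A point of [E] is
   within [r] of [K] and then within [r] of the representative, whence cubes of radius [2 r]. *)
pose c f := if pselect (exists x, near x /\ cell x = f) is left ex
  then projT1 (cid ex) else z.
have Ec : E `<=` \bigcup_f cube (c f) (2 * r).
  move=> x [yx /(delta_lt K0)[w Kw xw]].
  have nw : near w.
    split => //; rewrite (le_lt_trans (ler_edistD _ x _))//.
    rewrite (le_lt_trans (lerD (lexx _) (ler_edistD _ x0 _)))//.
    rewrite enorm_distC.
    have : enorm (x - x0) <= d%:R * (2 * rho).
      apply: enorm_le_coord => [|i]; first by rewrite mulr_ge0 ?ltW.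
      rewrite !mxE; have := yx i; have := yx0 i; rewrite !ltr_norml ler_norml.
      by lra.
    by rewrite /b; nra.
  exists (cell w) => // i.
  have : enorm (w - c (cell w)) <= r.
    rewrite /c; case: pselect => [ex|]; last by case; exists w.
    by case: (cid ex) => /= v [nv vw]; exact: cell_close.
  have /= := enorm_coord (x - c (cell w)) i; rewrite !mxE => /le_lt_trans + wc.
  apply; rewrite (le_lt_trans (ler_edistD _ w _))//.
  by rewrite mulr_natl mulr2n ltr_leD.
have s0 : 0 <= 2 * r by rewrite mulr_ge0// ltW.
apply: (le_trans (lebesgue_cover_cubes s0 mE Ec)); rewrite lee_fin.
rewrite card_ffun !card_ord natrX.
rewrite (_ : _ * _ * _ * _ = ((B + 1) * rho / r) ^+ (d - k) * (2 * (2 * r)) ^+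
  d).
  rewrite ler_pM2r ?exprn_gt0 ?mulr_gt0// lerXn2r ?nnegrE//.
    by rewrite divr_ge0 ?mulr_ge0 ?addr_ge0// ltW.
  (* The additional cell in [N.+1] is paid by [1 <= rho / r]; this is the 1 in [B + 1]. *)
  rewrite -addn1 natrD !mulrDl lerD//.
    by rewrite /N truncn_le divr_ge0 ?mulr_ge0// ltW.
  by rewrite mul1r ler_pdivlMr// mul1r.
rewrite (_ : 2 * (2 * r) = 4 * r); last by ring.
rewrite -[in (4 * r) ^+ _](subnK kd) exprD -[in 4 ^+ d](subnK kd) exprD !exprMn.
by rewrite exprVn; field; rewrite expf_neq0 ?gt_eqF.
Qed.

End regularity.

(** * Weights of the chain *)

Section power_inequalities.
Context {R : realType}.
Implicit Types (a b p q t : R).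

Lemma powRV a q : 0 <= a -> a^-1 `^ q = (a `^ q)^-1.
Proof.
by move=> a0; rewrite -powR_inv1// -powRrM mulN1r powRN.
Qed.

(** Convexity of the p-th power at the points [a / (1 - t)] and [b / t], with weights [1 - t] and
    [t]. *)
Lemma powR_le_split p t a b : 1 <= p -> 0 < t < 1 -> 0 <= a -> 0 <= b ->
  (a + b) `^ p <= (1 - t) `^ (1 - p) * a `^ p + t `^ (1 - p) * b `^ p.
Proof.
move=> p1 /andP[t0 t1] a0 b0.
have s0 : 0 < 1 - t by rewrite subr_gt0.
have scale c z : 0 < c -> 0 <= z -> c * (z / c) `^ p = c `^ (1 - p) * z `^ p.
  move=> c0 z0; rewrite powRM ?invr_ge0 ?(ltW c0)//.
  rewrite -(powR_inv1 (ltW c0)) -powRrM mulN1r powRD; last first.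
    by apply/implyP => _; rewrite gt_eqF.
  by rewrite powRr1 ?(ltW c0)//; ring.
have := @convex_powR R p p1 (Itv01 (ltW t0) (ltW t1)) (b / t) (a / (1 - t)).
rewrite !inE/= !in_itv/= !andbT (divr_ge0 b0 (ltW t0)) (divr_ge0 a0 (ltW s0)).
move=> /(_ isT isT).
rewrite -[X in _ <= X -> _]/(t * (b / t) `^ p + (1 - t) * (a / (1 - t)) `^ p).
rewrite -[X in X `^ p <= _ -> _]/(t * (b / t) + (1 - t) * (a / (1 - t))).
rewrite !scale// [X in _ <= X -> _]addrC; congr (_ `^ p <= _).
by field; rewrite !gt_eqF.
Qed.

(** With [x = 1 / (i + 2)] this is [1 - sqrt (1 - x) >= x / 2], that is, [(r - 1)^2 >= 0] for
    [r = sqrt (1 - x)]. *)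
Lemma sqrt_ratio_gap (i : nat) :
  (2 * i.+2%:R)^-1 <= 1 - (i.+1%:R / i.+2%:R : R) `^ 2^-1.
Proof.
have a0 : 0 <= i.+1%:R / i.+2%:R :> R by [].
rewrite powR12_sqrt//.
set s := Num.sqrt _.
have s2 : s ^+ 2 = i.+1%:R / i.+2%:R by rewrite sqr_sqrtr.
have sE : s ^+ 2 = 1 - i.+2%:R^-1.
  rewrite s2 -[i.+2%:R]natr1; field.
  by rewrite gt_eqF// addr_gt0.
rewrite invfM; suff key (x r : R) : r ^+ 2 = 1 - x -> 2^-1 * x <= 1 - r.
  exact: key.
by move=> rx; have := sqr_ge0 (r - 1); lra.
Qed.

(* Convexity with the weight [1 - t = sqrt ((i + 1) / (i + 2))]: the first
   coefficients telescope to a power of [i] strictly below [i `^ (p - 1)]. *)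
Lemma chain_step p q (i : nat) a b : 0 < q -> p = 1 + 2 * q ->
  0 <= a -> 0 <= b ->
  (a + b) `^ p <= i.+2%:R `^ q / i.+1%:R `^ q * a `^ p +
                  4 `^ q * i.+2%:R `^ q * i.+2%:R `^ q * b `^ p.
Proof.
move=> q0 pq a0 b0; have p1 : 1 < p by rewrite pq ltrDl mulr_gt0.
pose t : R := 1 - (i.+1%:R / i.+2%:R) `^ 2^-1.
have it := sqrt_ratio_gap i.
have t0 : 0 < t by apply: lt_le_trans it; rewrite invr_gt0 mulr_gt0.
have t1 : t < 1 by rewrite gtrBl powR_gt0// divr_gt0.
have t01 : 0 < t < 1 by rewrite t0.
apply: le_trans (powR_le_split (ltW p1) t01 a0 b0) _.
have {}pq : 1 - p = - (2 * q) by rewrite pq; ring.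
apply: lerD; rewrite ler_wpM2r ?powR_ge0//.
  rewrite /t opprB addrC subrK -powRrM pq mulrN mulrA mulVf// mul1r.
  by rewrite powRN powRM ?invr_ge0// powRV// invfM invrK mulrC.
rewrite pq powRN -mulrA -powRD; last by rewrite pnatr_eq0 implybT.
have -> : 4 `^ q * i.+2%:R `^ (q + q) = (2 * i.+2%:R) `^ (2 * q) :> R.
  rewrite powRM// (_ : q + q = 2 * q); last by ring.
  by rewrite (powRrM 2 2 q) powR_mulrn// -natrX.
rewrite -[2 * i.+2%:R]invrK [leRHS]powRV ?invr_ge0//.
rewrite lef_pV2 ?posrE ?powR_gt0 ?invr_gt0 ?mulr_gt0//.
by rewrite ge0_ler_powR ?nnegrE ?invr_ge0 ?mulr_ge0// ltW// mulr_gt0.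
Qed.

(* Discrete version of [t `^ (- 1 - q) = - (t `^ (- q) / q)^`()]. *)
Lemma powR_telescope q (j : nat) : 0 < q ->
  j.+1%:R `^ (- 1 - q) <=
  (2 / q + 1) * (j.+1%:R `^ (- q) - j.+2%:R `^ (- q)) :> R.
Proof.
(* [1 + v] is a lower bound for [((j + 2) / (j + 1)) ^ q], by [expR x >= 1 + x] and [ln ((j + 2) /
   (j + 1)) >= 1 / (j + 2) >= 1 / (2 (j + 1))]. As [v <= q / 2], one has
   [(2 / q) (1 + v) <= 2 / q + 1], which gives the constant. *)
move=> q0; pose v : R := q / (2 * j.+1%:R).
have v0 : 0 < v by rewrite divr_gt0// mulr_gt0.
have vq : v <= q / 2.
  rewrite /v invfM mulrA ler_piMr//; first by rewrite divr_ge0// ltW.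
  by rewrite invf_le1// ler1n.
have jv : 1 + v <= (j.+2%:R / j.+1%:R) `^ q.
  rewrite /powR ifF; last by rewrite gt_eqF ?divr_gt0.
  apply: le_trans (expR_ge1Dx _); rewrite lerD2l ler_pM2l//.
  rewrite -[X in ln X]invrK lnV ?posrE ?invr_gt0 ?divr_gt0// invf_div.
  have -> : j.+1%:R / j.+2%:R = 1 + - j.+2%:R^-1 :> R.
    by rewrite -[j.+2%:R]natr1; field; rewrite gt_eqF// addr_gt0.
  rewrite lerNr (le_trans (@le_ln1Dx _ _ _))//.
    by rewrite ltrN2 invf_lt1// ltr1n.
  rewrite lerN2 lef_pV2 ?posrE ?mulr_gt0//.
  by rewrite -natrM ler_nat mul2n -addnn addSn ltnS leq_addl.
set T := j.+1%:R `^ (- q).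
have T0 : 0 < T by rewrite powR_gt0.
have -> : j.+1%:R `^ (- 1 - q) = T / j.+1%:R.
  rewrite powRD; last by rewrite pnatr_eq0 implybT.
  by rewrite powR_inv1// mulrC.
have T1 : j.+2%:R `^ (- q) <= T / (1 + v).
  have -> : j.+2%:R `^ (- q) = T / (j.+2%:R / j.+1%:R) `^ q.
    rewrite /T powRM ?invr_ge0// powRV//.
    by rewrite !powRN invfM invrK mulrCA mulVf ?mulr1// gt_eqF// powR_gt0.
  rewrite ler_pM2l// lef_pV2// ?posrE ?powR_gt0 ?divr_gt0//.
  by rewrite addr_gt0.
apply: (@le_trans _ _ ((2 / q + 1) * (T - T / (1 + v)))); last first.
  by rewrite ler_pM2l ?lerD2l ?lerN2// addr_gt0// divr_gt0.
have -> : T / j.+1%:R = (2 / q) * T * v.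
  by rewrite /v; field; rewrite (gt_eqF q0) gt_eqF// ltr_wpDr.
rewrite -subr_ge0.
have -> : (2 / q + 1) * (T - T / (1 + v)) - 2 / q * T * v =
  T * v / (1 + v) * (2 / q) * (q / 2 - v).
  by field; rewrite !gt_eqF ?addr_gt0.
by rewrite mulr_ge0 ?subr_ge0// !mulr_ge0 ?invr_ge0 ?ltW// addr_gt0.
Qed.

(** A discrete Hardy inequality: after exchanging the sums, the tail of [j ^ (- 1 - q)] beyond i is
    of order [i ^ (- q)] and cancels the weight of [G i]. *)
Lemma weighted_double_sum_le q (G : nat -> R) (n : nat) : 0 < q ->
  (forall i, 0 <= G i) ->
  \sum_(j < n) j.+1%:R `^ (- 1 - q) * (\sum_(i < j.+1) i.+1%:R `^ q * G i) <=
  (2 / q + 1) * \sum_(i < n) G i.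
Proof.
move=> q0 G0; set C := 2 / q + 1.
have C0 : 0 < C by rewrite addr_gt0// divr_gt0.
pose S m := \sum_(i < m) i.+1%:R `^ q * G i.
have S0 m : 0 <= S m by rewrite sumr_ge0// => i _; rewrite mulr_ge0// powR_ge0.
(* The boundary term of the summation by parts is kept on the left; with it the induction closes by
   [powR_telescope]. *)
suff : \sum_(j < n) j.+1%:R `^ (- 1 - q) * S j.+1 + C * n.+1%:R `^ (- q) * S n
    <= C * \sum_(i < n) G i.
  by apply: le_trans; rewrite lerDl !mulr_ge0 ?powR_ge0// ltW.
elim: n => [|n IH]; first by rewrite /S !big_ord0 !mulr0 addr0.
rewrite !big_ord_recr/= mulrDr; apply: le_trans (lerD IH (lexx _)).
rewrite -!addrA lerD2l.
have SE : S n.+1 = S n + n.+1%:R `^ q * G n by rewrite /S big_ord_recr.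
have TG : C * n.+1%:R `^ (- q) * S n + C * G n = C * n.+1%:R `^ (- q) * S n.+1.
  by rewrite SE mulrDr; congr +%R; rewrite powRN -!mulrA mulKf//.
rewrite TG -mulrDl ler_wpM2r//.
by have := powR_telescope n q0; rewrite -/C mulrBr lerBrDr.
Qed.

End power_inequalities.

(** * Averages and Schur's test *)

Section section_integrals.
Context d (T : measurableType d) (R : realType).
Variable mu : {sigma_finite_measure set T -> \bar R}.
Local Open Scope ereal_scope.

Lemma measurable_integral_section (G : set (T * T)) (h : T * T -> \bar R) :
  measurable G -> measurable_fun setT h -> (forall z, 0 <= h z) ->
  measurable_fun setT (fun x => \int[mu]_(y in [set y | G (x, y)]) h (x, y)).
Proof.
move=> mG mh h0.
have mhG : measurable_fun setT (h \_ G).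
  by apply/(measurable_restrictT _ mG); exact: measurable_funS mh.
have hG0 z : 0 <= (h \_ G) z by exact: erestrict_ge0.
have := measurable_fun_fubini_tonelli_F (m2 := mu) _ mhG hG0.
congr (measurable_fun _ _); apply/funext => x;
  rewrite /fubini_F [RHS]integral_mkcond.
by apply: eq_integral => y _; rewrite !patchE.
Qed.

Lemma measurable_section_snd (G : set (T * T)) y :
  measurable G -> measurable [set x | G (x, y)].
Proof.
move=> mG; rewrite (_ : mkset _ = ysection G y);
  first exact: measurable_ysection.
by apply/seteqP; split=> x; rewrite /ysection/= in_setE.
Qed.

(** Tonelli: each [y] is counted with the measure of its fibre in [A], at most [m], and the fibre is
    empty unless [y] is in [B]. It converts integrals of chain costs over a layer into energies on a
    shell. *)
Lemma schur_le (A B : set T) (G : set (T * T)) (F : T -> \bar R) (m : R) :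
  measurable A -> measurable B -> measurable G ->
  measurable_fun setT F -> (forall x, 0 <= F x) ->
  (forall x y, A x -> G (x, y) -> B y) ->
  (0 <= m)%R -> (forall y, mu (A `&` [set x | G (x, y)]) <= m%:E) ->
  \int[mu]_(x in A) \int[mu]_(y in [set y | G (x, y)]) F y <=
  m%:E * \int[mu]_(y in B) F y.
Proof.
move=> mA mB mG mF F0 AGB m0 Gm.
pose k := (F \o snd) \_ ((A `*` setT) `&` G).
have mAG : measurable ((A `*` setT) `&` G).
  by apply: measurableI => //; exact: measurableX.
have mk : measurable_fun setT k.
  apply/(measurable_restrictT _ mAG);
    apply: (@measurable_funS _ _ _ _ setT) => //.
  exact: measurableT_comp mF measurable_snd.
have k0 z : 0 <= k z by apply: erestrict_ge0 => /=.
have -> : \int[mu]_(x in A) \int[mu]_(y in [set y | G (x, y)]) F y =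
    \int[mu]_x \int[mu]_y k (x, y).
  rewrite integral_mkcond; apply: eq_integral => x _; rewrite patchE.
  case: ifPn => [xA|xA].
    rewrite integral_mkcond; apply: eq_integral => y _.
    by rewrite /k !patchE/= in_setI in_setX/= xA in_setT.
  rewrite integral0_eq// => y _; rewrite /k patchE/= in_setI in_setX/=.
  by rewrite (negbTE xA).
rewrite (fubini_tonelli k)//.
have mB' : measurable_fun setT (F \_ B).
  by apply/(measurable_restrictT _ mB); exact: measurable_funS mF.
have mAGy y : measurable (A `&` [set x | G (x, y)]).
  by apply: measurableI => //; exact: measurable_section_snd.
have kE y : \int[mu]_x k (x, y) = F y * mu (A `&` [set x | G (x, y)]).
  rewrite -integral_cst// integral_mkcond; apply: eq_integral => x _.
  by rewrite /k !patchE/= in_setI in_setX/= in_setT andbT in_setI.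
have BE y : ~ B y -> A `&` [set x | G (x, y)] = set0.
  by move=> nBy; rewrite -subset0 => x [Ax /(AGB _ _ Ax)].
rewrite -ge0_integralZl//; last exact: measurable_funS mF.
rewrite [leRHS]integral_mkcond; apply: ge0_le_integral => //.
- by move=> y _; exact: integral_ge0.
- exact: (measurable_fun_fubini_tonelli_G (m1 := mu) _ mk k0).
- apply/(measurable_restrictT _ mB); apply: measurable_funeM.
  exact: measurable_funS mF.
- move=> y _; rewrite kE patchE; case: ifPn => [yB|/negP].
    by rewrite muleC lee_wpmul2r.
  by rewrite inE => /BE ->; rewrite measure0 mule0.
Qed.

Lemma average_point_le (F : set T) (f h : T -> \bar R) (c : \bar R) (a b : R) :
  measurable F -> measurable_fun setT f -> measurable_fun setT h ->
  (forall x, 0 <= f x) -> (forall x, 0 <= h x) -> 0 <= c ->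
  (0 <= a)%R -> (0 <= b)%R ->
  (forall z, F z -> c <= a%:E * f z + b%:E * h z) ->
  c * mu F <= a%:E * \int[mu]_(z in F) f z + b%:E * \int[mu]_(z in F) h z.
Proof.
move=> mF mf mh f0 h0 c0 a0 b0 cF.
have mf' : measurable_fun F f by exact: measurable_funS mf.
have mh' : measurable_fun F h by exact: measurable_funS mh.
rewrite -!ge0_integralZl// -ge0_integralD//; last 4 first.
- by move=> x _; rewrite mule_ge0.
- exact: measurable_funeM.
- by move=> x _; rewrite mule_ge0.
- exact: measurable_funeM.
rewrite -integral_cst//; apply: ge0_le_integral => //.
by apply: emeasurable_funD; exact: measurable_funeM.
Qed.

Lemma average_le (E F : set T) (f : T -> \bar R) (h : T * T -> \bar R)
    (a b : R) :
  measurable E -> measurable F ->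
  measurable_fun setT f -> measurable_fun setT h ->
  (forall x, 0 <= f x) -> (forall x, 0 <= h x) -> (0 <= a)%R -> (0 <= b)%R ->
  (forall y z, E y -> F z -> f y <= a%:E * f z + b%:E * h (y, z)) ->
  (\int[mu]_(y in E) f y) * mu F <=
  a%:E * (mu E * \int[mu]_(z in F) f z) +
  b%:E * \int[mu]_(y in E) \int[mu]_(z in F) h (y, z).
Proof.
move=> mE mF mf mh f0 h0 a0 b0 EF.
have mfE : measurable_fun E f by exact: measurable_funS mf.
have mhE : measurable_fun E (fun y => \int[mu]_(z in F) h (y, z)).
  apply: (@measurable_funS _ _ _ _ setT) => //.
  have := @measurable_integral_section (setT `*` F) h _ mh h0.
  rewrite (_ : (fun x => _) = (fun y => \int[mu]_(z in F) h (y, z))).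
    by apply; exact: measurableX.
  apply/funext => x; congr (integral _ _ _).
  by apply/seteqP; split => // z [].
have hE0 y : 0 <= \int[mu]_(z in F) h (y, z) by exact: integral_ge0.
set I := \int[mu]_(z in F) f z.
have I0 : 0 <= I by exact: integral_ge0.
have -> : a%:E * (mu E * I) = \int[mu]_(y in E) (cst (a%:E * I) y).
  by rewrite integral_cst// muleCA muleC.
rewrite muleC -ge0_integralZl// -[X in _ + X]ge0_integralZl//.
rewrite -ge0_integralD//; last 3 first.
- by move=> x _; rewrite mule_ge0.
- by move=> x _; rewrite mule_ge0.
- exact: measurable_funeM.
apply: ge0_le_integral => //.
- by move=> y _; rewrite mule_ge0.
- exact: measurable_funeM.
- by apply: emeasurable_funD => //; exact: measurable_funeM.
- move=> y Ey; rewrite muleC.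
  apply: average_point_le => //; last by move=> z Fz; exact: EF.
  exact: measurableT_comp mh (measurable_pair1 y).
Qed.

End section_integrals.

(** * The chain of averages *)

Section gagliardo_density.
Context {R : realType} {d : nat}.
Variables (Omega : set 'rV[R]_d) (p : R) (k : nat) (u : 'rV[R]_d -> R).
Hypotheses (mOmega : measurable Omega) (p0 : 0 < p)
  (mu_u : measurable_fun setT u).
Local Notation mu := (lebesgue_rV R d).
Local Open Scope ereal_scope.

(** The Gagliardo kernel in the critical case: [sigma p = k] makes the exponent [d + sigma p] a
    natural number, so distances can be handled with integer powers. On the diagonal its value is
    0. *)
Definition gkernel (yz : 'rV[R]_d * 'rV[R]_d) : \bar R :=
  (`|u yz.1 - u yz.2| `^ p / enorm (yz.1 - yz.2) `^ (d + k)%:R)%R%:E.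

Definition gdensity (y : 'rV[R]_d) : \bar R :=
  \int[mu]_(z in Omega) gkernel (y, z).

Lemma gkernel_ge0 yz : 0 <= gkernel yz.
Proof. by rewrite lee_fin divr_ge0// powR_ge0. Qed.

Lemma gdensity_ge0 y : 0 <= gdensity y.
Proof. by apply: integral_ge0 => z _; exact: gkernel_ge0. Qed.

Let mu1 : measurable_fun [set: 'rV[R]_d * 'rV[R]_d] (u \o fst).
Proof. exact: measurableT_comp mu_u measurable_fst. Qed.

Let mu2 : measurable_fun [set: 'rV[R]_d * 'rV[R]_d] (u \o snd).
Proof. exact: measurableT_comp mu_u measurable_snd. Qed.

Lemma measurable_powR_norm : measurable_fun setT (fun y => (`|u y| `^ p)%:E).
Proof.
apply/measurable_EFinP.
apply: (measurableT_comp (measurable_powR p)).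
exact: measurableT_comp mu_u.
Qed.

Let measurable_powR_dist : measurable_fun setT
  (fun yz : 'rV[R]_d * 'rV[R]_d => `|u yz.1 - u yz.2| `^ p)%R.
Proof.
apply: (measurableT_comp (measurable_powR p)).
by apply: measurableT_comp => //; exact: measurable_funB.
Qed.

Lemma measurable_gkernel : measurable_fun setT gkernel.
Proof.
apply/measurable_EFinP; apply: measurable_funM.
  exact: measurable_powR_dist.
rewrite (_ : (fun _ => _) = (fun t => t `^ (- (d + k)%:R))%R \o
  (fun yz : 'rV[R]_d * 'rV[R]_d => enorm (yz.1 - yz.2))).
  apply: (measurableT_comp (measurable_powR _)).
  apply: measurable_enorm; apply: measurable_funB_rV.
    exact: measurable_fst.
  exact: measurable_snd.
by apply/funext => yz /=; rewrite powRN.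
Qed.

Lemma measurable_gdensity : measurable_fun setT gdensity.
Proof.
have mG : measurable (setT `*` Omega : set ('rV[R]_d * 'rV[R]_d)).
  exact: measurableX.
have := @measurable_integral_section _ _ _ mu _ _ mG measurable_gkernel
  gkernel_ge0.
congr (measurable_fun _ _); apply/funext => y; congr (integral _ _ _).
by apply/seteqP; split => z // [].
Qed.

Lemma dist_le_gkernel y z (D : R) : (enorm (y - z) <= D)%R ->
  (`|u y - u z| `^ p)%:E <= (D ^+ (d + k))%:E * gkernel (y, z).
Proof.
move=> yzD; rewrite /gkernel -EFinM lee_fin/= powR_mulrn ?enorm_ge0//.
have [yz0|yz0] := eqVneq (enorm (y - z)) 0%R.
  have /eqP := enorm_eq0 yz0; rewrite subr_eq0 => /eqP ->.
  by rewrite !subrr normr0 powR0 ?gt_eqF// mul0r mulr0.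
have {}yz0 : (0 < enorm (y - z))%R by rewrite lt_neqAle eq_sym yz0 enorm_ge0.
rewrite mulrCA ler_peMr ?powR_ge0// ler_pdivlMr ?exprn_gt0// mul1r.
by rewrite lerXn2r ?nnegrE// ltW// (lt_le_trans yz0).
Qed.

(** The coefficients of the convexity inequality stay abstract because they change along the chain:
    they depend on the index for jumps between scales and are fixed for the last jump to a point. *)
Variables (A B : R).
Hypotheses (A0 : (0 <= A)%R) (B0 : (0 <= B)%R).
Hypothesis convAB : forall a b : R, (0 <= a)%R -> (0 <= b)%R ->
  ((a + b) `^ p <= A * a `^ p + B * b `^ p)%R.

Let f y : \bar R := (`|u y| `^ p)%:E.

Let f_ge0 y : 0 <= f y. Proof. by rewrite lee_fin powR_ge0. Qed.

Lemma powR_norm_le y z :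
  f y <= A%:E * f z + B%:E * (`|u y - u z| `^ p)%:E.
Proof.
rewrite -!EFinM -EFinD lee_fin (le_trans _ (convAB _ _))//.
rewrite ge0_ler_powR ?nnegrE ?addr_ge0//; first exact: ltW.
by rewrite -[in leLHS](subrK (u z) (u y)) addrC ler_normD.
Qed.

Lemma chain_point_le x F (m D : R) : measurable F -> F `<=` Omega ->
  (0 < m)%R -> mu F = m%:E -> (0 <= D)%R ->
  (forall z, F z -> (enorm (x - z) <= D)%R) ->
  f x <= A%:E * (m^-1%:E * \int[mu]_(z in F) f z) +
    (B * D ^+ (d + k) / m)%:E * gdensity x.
Proof.
move=> mF FO m0 muF D0 FD.
have key : f x * m%:E <= A%:E * \int[mu]_(z in F) f z +
    (B * D ^+ (d + k))%:E * \int[mu]_(z in F) gkernel (x, z).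
  rewrite -muF; apply: average_point_le => //.
  - exact: measurable_powR_norm.
  - exact: measurableT_comp measurable_gkernel (measurable_pair1 x).
  - by move=> z; exact: gkernel_ge0.
  - by rewrite mulr_ge0// exprn_ge0.
  move=> z Fz; apply: (le_trans (powR_norm_le x z)).
  by rewrite leeD2l// EFinM -muleA lee_wpmul2l// dist_le_gkernel// FD.
have FG : \int[mu]_(z in F) gkernel (x, z) <= gdensity x.
  apply: ge0_subset_integral => //; last by move=> z _; exact: gkernel_ge0.
  apply: (@measurable_funS _ _ _ _ setT) => //.
  exact: measurableT_comp measurable_gkernel (measurable_pair1 x).
have -> : f x = m^-1%:E * (f x * m%:E).
  by rewrite /f -!EFinM mulrCA mulVf ?mulr1// gt_eqF.
apply: (@le_trans _ _ (m^-1%:E * (A%:E * \int[mu]_(z in F) f z +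
    (B * D ^+ (d + k))%:E * gdensity x))).
  rewrite lee_wpmul2l//; first by rewrite lee_fin invr_ge0 ltW.
  apply: (le_trans key); rewrite leeD2l// lee_wpmul2l// lee_fin.
  by rewrite mulr_ge0// exprn_ge0.
rewrite ge0_muleDr; last 2 first.
- by rewrite mule_ge0// integral_ge0.
- by rewrite mule_ge0 ?gdensity_ge0// lee_fin mulr_ge0// exprn_ge0.
by apply: leeD; [rewrite muleCA|rewrite muleA -EFinM mulrC].
Qed.

(** The convexity inequality is averaged over [E] and [F], with [D ^ (d + k)] times the kernel in
    place of the differences. Enlarging the inner integral from [F] to [Omega] leaves only the
    energy density on [E], a quantity attached to a single scale. *)
Lemma chain_average_le E F (mE mF D : R) : measurable E -> measurable F ->
  F `<=` Omega -> (0 < mE)%R -> (0 < mF)%R -> mu E = mE%:E -> mu F = mF%:E ->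
  (0 <= D)%R -> (forall y z, E y -> F z -> (enorm (y - z) <= D)%R) ->
  mE^-1%:E * \int[mu]_(y in E) f y <=
    A%:E * (mF^-1%:E * \int[mu]_(z in F) f z) +
    (B * D ^+ (d + k) / (mE * mF))%:E * \int[mu]_(y in E) gdensity y.
Proof.
move=> mEm mFm FO mE0 mF0 muE muF D0 EFD.
have key : (\int[mu]_(y in E) f y) * mF%:E <=
    A%:E * (mE%:E * \int[mu]_(z in F) f z) +
    (B * D ^+ (d + k))%:E * \int[mu]_(y in E) gdensity y.
  rewrite -muE -muF; apply: le_trans.
    apply: (@average_le _ _ _ mu E F f gkernel A (B * D ^+ (d + k))) => //.
    - exact: measurable_powR_norm.
    - exact: measurable_gkernel.
    - exact: gkernel_ge0.
    - by rewrite mulr_ge0// exprn_ge0.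
    move=> y z Ey Fz; apply: (le_trans (powR_norm_le y z)).
    by rewrite leeD2l// EFinM -muleA lee_wpmul2l// dist_le_gkernel// EFD.
  rewrite leeD2l// lee_wpmul2l//.
    by rewrite lee_fin mulr_ge0// exprn_ge0.
  apply: ge0_le_integral => //.
  - by move=> y _; apply: integral_ge0 => z _; exact: gkernel_ge0.
  - apply: (@measurable_funS _ _ _ _ setT) => //.
    have mG : measurable (setT `*` F : set ('rV[R]_d * 'rV[R]_d)).
      exact: measurableX.
    have := @measurable_integral_section _ _ _ mu _ _ mG measurable_gkernel
      gkernel_ge0.
    congr (measurable_fun _ _); apply/funext => y; congr (integral _ _ _).
    by apply/seteqP; split => z // [].
  - apply: (@measurable_funS _ _ _ _ setT) => //.
    exact: measurable_gdensity.
  - move=> y Ey; apply: ge0_subset_integral => //.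
      apply: (@measurable_funS _ _ _ _ setT) => //.
      exact: measurableT_comp measurable_gkernel (measurable_pair1 y).
    by move=> z _; exact: gkernel_ge0.
set IE := \int[mu]_(y in E) f y in key *; set IF := \int[mu]_(z in F) f z.
have IE0 : 0 <= IE by exact: integral_ge0.
have IF0 : 0 <= IF by exact: integral_ge0.
have IG0 : 0 <= \int[mu]_(y in E) gdensity y.
  by apply: integral_ge0 => y _; exact: gdensity_ge0.
have BD0 : (0 <= B * D ^+ (d + k))%R by rewrite mulr_ge0// exprn_ge0.
have -> : mE^-1%:E * IE = ((mE * mF)^-1)%:E * (IE * mF%:E).
  rewrite [LHS]muleC [RHS]muleCA -EFinM; congr (_ * _%:E).
  by field; rewrite !gt_eqF.
apply: (@le_trans _ _ ((mE * mF)^-1%:E * (A%:E * (mE%:E * IF) +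
    (B * D ^+ (d + k))%:E * \int[mu]_(y in E) gdensity y))).
  by rewrite lee_wpmul2l// lee_fin invr_ge0 mulr_ge0 ?ltW.
rewrite ge0_muleDr; last 2 first.
- by rewrite !mule_ge0// lee_fin ltW.
- by rewrite mule_ge0// lee_fin.
apply: leeD; last by rewrite muleA -EFinM mulrC.
rewrite muleCA lee_wpmul2l// muleA -EFinM (_ : (_ * _)%R = mF^-1%R)//.
by field; rewrite !gt_eqF.
Qed.

End gagliardo_density.

(** * Porous cubes and chains of averages across scales *)

Section porosity.
Context {R : realType} {d : nat}.
Variables (K : set 'rV[R]_d) (k : nat) (C r0 : R).
Hypotheses (K0 : K !=set0) (k0 : (0 < k)%N) (kd : (k <= d)%N) (C0 : 0 < C)
  (regK : codim_regular k K C r0).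
Variable beta : R.
Hypotheses (beta0 : 0 < beta) (beta1 : beta <= 1) (Cbeta : C * beta <= 2^-1).
Local Notation mu := (lebesgue_rV R d).
Implicit Types (x y z : 'rV[R]_d).

Definition porous_cube x r : set 'rV[R]_d :=
  cube x r `&` [set y | beta * r <= delta K y].

Lemma measurable_delta_ge t : measurable [set y | t <= delta K y].
Proof.
rewrite (_ : mkset _ = ~` [set y | delta K y < t]); last first.
  by apply/seteqP; split=> y /=; rewrite leNgt => /negP.
by apply: measurableC; apply: open_measurable_rV; exact: open_delta_lt.
Qed.

Lemma measurable_delta_lt t : measurable [set y | delta K y < t].
Proof. by apply: open_measurable_rV; exact: open_delta_lt. Qed.

Lemma measurable_porous_cube x r : measurable (porous_cube x r).
Proof.
by apply: measurableI; [exact: measurable_cube|exact: measurable_delta_ge].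
Qed.

Lemma measurable_porous_cube_pair r : measurable
  [set xy : 'rV[R]_d * 'rV[R]_d | porous_cube xy.1 r xy.2].
Proof.
rewrite (_ : mkset _ = [set xy | cube xy.1 r xy.2] `&`
    (setT `*` [set y | beta * r <= delta K y])); last first.
  by apply/seteqP; split => -[x y] /=; [case|move=> [? []]].
apply: measurableI; first exact: measurable_cube_pair.
by apply: measurableX => //; exact: measurable_delta_ge.
Qed.

(** The part of the cube with [delta K y < beta * r] has measure at most
    [C beta^k r^d <= C beta r^d <= r^d / 2], whereas the whole cube has measure at least [r^d]. *)
Lemma porous_cube_measure x r : 0 < r -> r <= r0 ->
  exists2 m, r ^+ d / 2 <= m & mu (porous_cube x r) = m%:E.
Proof.
move=> r_gt0 rr0; have mP := measurable_porous_cube x r.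
have mQ := measurable_cube x r.
have muQ := lebesgue_cube x (ltW r_gt0).
have Pfin : mu (porous_cube x r) \is a fin_num.
  rewrite ge0_fin_numE//; apply: (@le_lt_trans _ _ (mu (cube x r))).
    by apply: le_measure; rewrite ?inE//; exact: subIsetl.
  by rewrite muQ ltry.
exists (fine (mu (porous_cube x r))); last by rewrite fineK.
have br0 : 0 < beta * r by rewrite mulr_gt0.
have brr : beta * r <= r by rewrite ler_piMl// ltW.
have := regK x br0 brr rr0; set L := cube x r `&` _ => Lle.
have mL : measurable L by apply: measurableI => //; exact: measurable_delta_lt.
have QU : cube x r = L `|` porous_cube x r.
  rewrite /L /porous_cube -setIUr (_ : _ `|` _ = setT) ?setIT//.
  by apply/seteqP; split => // y _ /=; case: ltP; [left|right].
have : (((2 * r) ^+ d)%:E <= mu L + mu (porous_cube x r))%E.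
  by rewrite -muQ QU; exact: measureU2.
move=> /le_trans/(_ (leeD2r _ Lle)); rewrite -{1}(fineK Pfin) -EFinD lee_fin.
set m := fine _ => rm.
have Lr : C * r ^+ (d - k) * (beta * r) ^+ k <= r ^+ d / 2.
  rewrite exprMn mulrACA -exprD subnK// [leLHS]mulrC ler_pM2l ?exprn_gt0//.
  apply: le_trans Cbeta; rewrite ler_pM2l//.
  by rewrite -[leRHS]expr1 ler_wiXn2l// ltW.
have rr : r ^+ d <= (2 * r) ^+ d.
  by rewrite lerXn2r ?nnegrE ?mulr_ge0 ?(ltW r_gt0)//; lra.
lra.
Qed.


Variables (Omega : set 'rV[R]_d) (p q : R) (u : 'rV[R]_d -> R).
Hypotheses (mOmega : measurable Omega) (q0 : 0 < q) (pq : p = 1 + 2 * q)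
  (mu_u : measurable_fun setT u).
Variables (lam rho0 : R).
Hypotheses (lam0 : 0 < lam) (lam1 : lam <= 1) (rho00 : 0 < rho0)
  (rho0r0 : rho0 <= r0) (betaE : beta = (1 + d%:R) * lam)
  (collar : forall x, delta K x < (1 + d%:R) * rho0 -> Omega x).

Let p0 : 0 < p. Proof. by rewrite pq addr_gt0// mulr_gt0. Qed.

Definition scale (i : nat) : R := rho0 * lam ^+ i.

Lemma scale_gt0 i : 0 < scale i.
Proof. by rewrite mulr_gt0// exprn_gt0. Qed.

Lemma scaleS i : scale i.+1 = lam * scale i.
Proof. by rewrite /scale exprS mulrCA. Qed.

Lemma le_scale i j : (i <= j)%N -> scale j <= scale i.
Proof.
by move=> ij; rewrite ler_pM2l// ler_wiXn2l// ltW.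
Qed.

Lemma scale_le_rho0 i : scale i <= rho0.
Proof. by rewrite (le_trans (le_scale (leq0n i)))// /scale expr0 mulr1. Qed.

(* The factor [1 + d] makes [shell i] contain [porous_cube x (scale i)] as soon
   as [delta K x < scale i]; the choice [beta = (1 + d) * lam] keeps the shells
   pairwise disjoint. *)
Definition shell i : set 'rV[R]_d :=
  [set y | (1 + d%:R) * scale i.+1 <= delta K y < (1 + d%:R) * scale i].

Lemma cube_enorm x y r : 0 <= r -> cube x r y -> enorm (y - x) <= d%:R * r.
Proof.
by move=> r_0 xy; apply: enorm_le_coord => // i; rewrite !mxE ltW// xy.
Qed.

Lemma porous_cube_shell x i : delta K x < scale i ->
  porous_cube x (scale i) `<=` shell i.
Proof.
move=> xi y [xy iy]; rewrite /shell/=; apply/andP; split.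
  by rewrite scaleS mulrA -betaE.
rewrite (le_lt_trans (delta_lip y x K0))// mulrDl mul1r addrC ltr_leD//.
by apply: cube_enorm => //; exact: ltW (scale_gt0 i).
Qed.

Lemma shell_Omega i : shell i `<=` Omega.
Proof.
move=> y /andP[_ yi]; apply: collar; apply: lt_le_trans yi _.
by rewrite ler_pM2l ?scale_le_rho0// ltr_pwDl.
Qed.

Local Open Scope ereal_scope.

Let f y : \bar R := (`|u y| `^ p)%:E.

Let f_ge0 y : 0 <= f y. Proof. by rewrite lee_fin powR_ge0. Qed.

Let Gam := gdensity Omega p k u.

(** [4 ^ q] comes from [chain_step], [2 d / lam] is the ratio of the largest distance between two
    consecutive porous cubes to the finer scale, and 4 comes from the two lower bounds
    [scale ^ d / 2] on their measures. *)
Definition chain_const : R := 4 `^ q * (2 * d%:R / lam) ^+ (d + k) * 4.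

Lemma chain_const_ge0 : (0 <= chain_const)%R.
Proof.
rewrite mulr_ge0// mulr_ge0 ?powR_ge0// exprn_ge0// divr_ge0 ?mulr_ge0//.
exact: ltW.
Qed.

(** [chain_step] charges a jump twice the exponent q; one half is carried by the common prefactor of
    the chain and the other remains here. The quotient of scales is [scale ^ (d + k)] divided by the
    product of two cube measures. *)
Definition chain_weight (i : nat) : R :=
  chain_const * i.+1%:R `^ q * (scale i ^+ k / scale i ^+ d).

Lemma chain_weight_ge0 i : (0 <= chain_weight i)%R.
Proof.
have s0 := ltW (scale_gt0 i).
by rewrite mulr_ge0 ?divr_ge0 ?exprn_ge0// mulr_ge0 ?chain_const_ge0 ?powR_ge0.
Qed.

Definition chain_sum (j : nat) x : \bar R :=
  (2 / rho0 ^+ d)%:E * \int[mu]_(y in porous_cube x (scale 0)) f y +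
  \sum_(i < j.+1)
    (chain_weight i)%:E * \int[mu]_(y in porous_cube x (scale i)) Gam y.

Let int_f_ge0 E : 0 <= \int[mu]_(y in E) f y.
Proof. exact: integral_ge0. Qed.

Let int_Gam_ge0 E : 0 <= \int[mu]_(y in E) Gam y.
Proof. by apply: integral_ge0 => y _; exact: gdensity_ge0. Qed.

Lemma chain_sum_ge0 j x : 0 <= chain_sum j x.
Proof.
apply: adde_ge0.
  by rewrite mule_ge0// lee_fin divr_ge0// exprn_ge0// ltW.
by apply: sume_ge0 => i _; rewrite mule_ge0// lee_fin chain_weight_ge0.
Qed.

(* Induction on [j]: the average over the porous cube of scale [j.+1] is
   compared to the one of scale [j] by [chain_average_le] with the coefficients
     of
   [chain_step], whose first one is the ratio of consecutive [j.+1 `^ q]. *)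
Lemma average_le_chain_sum x j : (delta K x < scale j)%R ->
  exists2 m : R, (scale j ^+ d / 2 <= m)%R &
    mu (porous_cube x (scale j)) = m%:E /\
    m^-1%:E * \int[mu]_(y in porous_cube x (scale j)) f y <=
    (j.+1%:R `^ q)%:E * chain_sum j x.
Proof.
elim: j => [|j IH] xj.
  have [|m rm muE] := @porous_cube_measure x (scale 0) (scale_gt0 0).
    exact: le_trans (scale_le_rho0 0) rho0r0.
  have m0 : (0 < m)%R.
    by apply: lt_le_trans rm; rewrite divr_gt0// exprn_gt0// scale_gt0.
  exists m => //; split => //; rewrite powR1 mul1e /chain_sum.
  rewrite -[leLHS]adde0 leeD//; last first.
    by apply: sume_ge0 => i _; rewrite mule_ge0// lee_fin chain_weight_ge0.
  rewrite lee_wpmul2r// lee_fin -[leRHS]invf_div lef_pV2 ?posrE//.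
    by move: rm; rewrite /scale expr0 mulr1.
  by rewrite divr_gt0// exprn_gt0.
have jj : (scale j.+1 <= scale j)%R by exact: le_scale.
have xj' : (delta K x < scale j)%R by exact: lt_le_trans jj.
have [mF rmF [muF IHF]] := IH xj'.
have [|mE rmE muE] := @porous_cube_measure x (scale j.+1) (scale_gt0 _).
  exact: le_trans (scale_le_rho0 _) rho0r0.
have sd0 i : (0 < scale i ^+ d / 2)%R.
  by rewrite divr_gt0// exprn_gt0// scale_gt0.
have mF0 := lt_le_trans (sd0 _) rmF; have mE0 := lt_le_trans (sd0 _) rmE.
exists mE => //; split => //.
(* Coefficients of [chain_step] at index j. The bound [D] passes through the common centre [x], with
   both cubes measured at the coarser [scale j]. *)
pose A : R := (j.+2%:R `^ q / j.+1%:R `^ q)%R.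
pose B : R := (4 `^ q * j.+2%:R `^ q * j.+2%:R `^ q)%R.
pose D : R := (2 * d%:R / lam * scale j.+1)%R.
have D0 : (0 <= D)%R.
  rewrite mulr_ge0//; last exact: ltW (scale_gt0 _).
  by rewrite divr_ge0 ?mulr_ge0// ltW.
have DE : (D = d%:R * scale j + d%:R * scale j)%R.
  by rewrite /D scaleS; field; rewrite gt_eqF.
apply: le_trans.
  apply: (@chain_average_le _ _ Omega p k u mOmega p0 mu_u A B _ _ _
    (porous_cube x (scale j.+1)) (porous_cube x (scale j)) mE mF D) => //.
  - by rewrite divr_ge0 ?powR_ge0.
  - by rewrite !mulr_ge0 ?powR_ge0.
  - by move=> a b a0 b0; exact: chain_step.
  - exact: measurable_porous_cube.
  - exact: measurable_porous_cube.
  - by apply: subset_trans (@shell_Omega j); exact: porous_cube_shell.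
  - move=> y z [xy _] [xz _]; rewrite (le_trans (ler_edistD y x z))// DE.
    apply: lerD.
      apply: le_trans (cube_enorm (ltW (scale_gt0 _)) xy) _.
      by rewrite ler_wpM2l.
    by rewrite enorm_distC; exact: cube_enorm (ltW (scale_gt0 _)) xz.
have A0 : (0 <= A)%R by rewrite divr_ge0 ?powR_ge0.
rewrite /chain_sum big_ord_recr/= addeA -/(chain_sum j x).
rewrite [leRHS]ge0_muleDr ?chain_sum_ge0//; last first.
  by rewrite mule_ge0// lee_fin chain_weight_ge0.
apply: leeD.
  apply: (@le_trans _ _ (A%:E * ((j.+1%:R `^ q)%:E * chain_sum j x))).
    by rewrite lee_wpmul2l.
  by rewrite muleA -EFinM /A mulfVK// gt_eqF// powR_gt0.
rewrite muleA -EFinM lee_wpmul2r// lee_fin /chain_weight /chain_const.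
have -> : (B * D ^+ (d + k) / (mE * mF) = j.+2%:R `^ q *
   (4 `^ q * (2 * d%:R / lam) ^+ (d + k) * j.+2%:R `^ q *
     (scale j.+1 ^+ (d + k) / (mE * mF))))%R.
  by rewrite /B /D exprMn; ring.
rewrite ler_pM2l ?powR_gt0//; set s := scale j.+1.
have s0 : (0 < s)%R by exact: scale_gt0.
set L := ((2 * d%:R / lam) ^+ (d + k))%R.
have -> : (4 `^ q * L * 4 * j.+2%:R `^ q * (s ^+ k / s ^+ d) =
    4 `^ q * L * j.+2%:R `^ q * (4 * (s ^+ k / s ^+ d)))%R by ring.
apply: ler_wpM2l.
  rewrite !mulr_ge0 ?powR_ge0// exprn_ge0// divr_ge0 ?mulr_ge0//.
  exact: ltW.
have -> : (4 * (s ^+ k / s ^+ d) =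
    s ^+ (d + k) / ((s ^+ d / 2) * (s ^+ d / 2)))%R.
  by rewrite exprD; field; rewrite gt_eqF// exprn_gt0.
rewrite ler_pM2l ?exprn_gt0// lef_pV2 ?posrE ?mulr_gt0 ?exprn_gt0//.
apply: ler_pM => //; [exact/ltW/sd0|exact/ltW/sd0|].
apply: le_trans rmF; rewrite ler_pM2r// lerXn2r ?nnegrE ?(ltW s0)//.
exact: ltW (scale_gt0 _).
Qed.

(** [chain_step] at index 0 gives the powers of q, the measure bound gives 2, and [d * scale j]
    bounds the distance from [x] to its porous cube. *)
Definition point_const : R :=
  4 `^ q * 2 `^ q * 2 `^ q * 2 * d%:R ^+ (d + k).

Lemma point_const_ge0 : (0 <= point_const)%R.
Proof. by rewrite !mulr_ge0 ?powR_ge0// exprn_ge0. Qed.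

(** The last jump, from the average at scale j to the point [x]. It occurs once per point, so the
    fixed coefficients at index 0 suffice and no further power of j is lost. *)
Lemma chain_pointwise x j : (delta K x < scale j)%R ->
  f x <= (2 `^ q * j.+1%:R `^ q)%:E * chain_sum j x +
         (point_const * scale j ^+ k)%:E * Gam x.
Proof.
move=> xj; have [m sm [muE IH]] := average_le_chain_sum xj.
have s0 := scale_gt0 j.
have m0 : (0 < m)%R by apply: lt_le_trans sm; rewrite divr_gt0// exprn_gt0.
have step a b : (0 <= a -> 0 <= b ->
    (a + b) `^ p <= 2 `^ q * a `^ p + 4 `^ q * 2 `^ q * 2 `^ q * b `^ p)%R.
  by move=> a0 b0; have := chain_step 0 q0 pq a0 b0; rewrite powR1 divr1.
apply: le_trans.
  have A0 : (0 <= 2 `^ q :> R)%R by exact: powR_ge0.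
  have B0 : (0 <= 4 `^ q * 2 `^ q * 2 `^ q :> R)%R by rewrite !mulr_ge0
    ?powR_ge0.
  apply: (@chain_point_le _ _ Omega p k u mOmega p0 mu_u _ _ A0 B0 step x
    (porous_cube x (scale j)) m (d%:R * scale j)) => //.
  - exact: measurable_porous_cube.
  - by apply: subset_trans (@shell_Omega j); exact: porous_cube_shell.
  - by rewrite mulr_ge0// ltW.
  - move=> z [xz _]; rewrite enorm_distC; exact: cube_enorm (ltW s0) xz.
apply: leeD.
  by rewrite EFinM -muleA lee_wpmul2l// lee_fin powR_ge0.
rewrite lee_wpmul2r ?gdensity_ge0// lee_fin /point_const exprMn.
set B := (4 `^ q * _ * _)%R.
have B0 : (0 <= B)%R by rewrite !mulr_ge0 ?powR_ge0.
have -> : (B * 2 * d%:R ^+ (d + k) * scale j ^+ k =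
    B * (d%:R ^+ (d + k) * scale j ^+ (d + k)) / (scale j ^+ d / 2))%R.
  by rewrite (exprD (scale j)); field; rewrite gt_eqF// exprn_gt0.
apply: ler_wpM2l.
  by rewrite mulr_ge0// mulr_ge0// exprn_ge0// ltW.
by rewrite lef_pV2 ?posrE// divr_gt0// exprn_gt0.
Qed.

(** Layers sort the points [x] at which u is estimated, shells the points [y] of their porous cubes;
    the thresholds differ by the factor [1 + d]. *)
Definition layer j : set 'rV[R]_d :=
  [set x | scale j.+1 <= delta K x < scale j]%R.

Lemma measurable_delta_itv s t : measurable [set x | s <= delta K x < t]%R.
Proof.
rewrite (_ : mkset _ = [set y | s <= delta K y]%R `&` [set y | delta K y <
  t]%R).
  apply: measurableI; [exact: measurable_delta_ge|exact: measurable_delta_lt].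
by apply/seteqP; split=> x /=; [move=> /andP|move=> [-> ->]].
Qed.

Lemma measurable_layer j : measurable (layer j).
Proof. exact: measurable_delta_itv. Qed.

Lemma measurable_shell j : measurable (shell j).
Proof. exact: measurable_delta_itv. Qed.

(** For fixed [y] the admissible [x] lie in [cube y (scale i)] at distance less than [scale j] from
    [K]; regularity bounds the measure of this set, since [scale j <= scale i]. *)
Lemma layer_porous_integral_le (F : 'rV[R]_d -> \bar R) i j : (i <= j)%N ->
  measurable_fun setT F -> (forall x, 0 <= F x) ->
  \int[mu]_(x in layer j) \int[mu]_(y in porous_cube x (scale i)) F y <=
  (C * scale i ^+ (d - k) * scale j ^+ k)%:E * \int[mu]_(y in shell i) F y.
Proof.
move=> ij mF F0.
pose G := [set xy : 'rV[R]_d * 'rV[R]_d | porous_cube xy.1 (scale i) xy.2].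
have mG : measurable G by exact: measurable_porous_cube_pair.
have := @schur_le _ _ _ mu (layer j) (shell i) G F
  (C * scale i ^+ (d - k) * scale j ^+ k) (measurable_layer j)
  (measurable_shell i) mG mF F0; apply.
- move=> x y /andP[_ xj]; apply: porous_cube_shell.
  exact: lt_le_trans xj (le_scale ij).
- by rewrite !mulr_ge0 ?exprn_ge0// ltW// scale_gt0.
move=> y; apply: (@le_trans _ _
    (mu (cube y (scale i) `&` [set x | (delta K x < scale j)%R]))).
  apply: le_measure; rewrite ?inE.
  - by apply: measurableI;
    [exact: measurable_layer|exact: measurable_section_snd].
  - apply: measurableI; [exact: measurable_cube|exact: measurable_delta_lt].
  - by move=> x [/andP[_ xj] [xy _]]; split => //; rewrite -cubeC.
apply: regK; [exact: scale_gt0|exact: le_scale|].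
exact: le_trans (scale_le_rho0 i) rho0r0.
Qed.

Let mf : measurable_fun setT f.
Proof. exact: measurable_powR_norm. Qed.

Let mGam : measurable_fun setT Gam.
Proof. exact: measurable_gdensity. Qed.

Lemma measurable_porous_integral (F : 'rV[R]_d -> \bar R) r :
  measurable_fun setT F -> (forall x, 0 <= F x) ->
  measurable_fun setT (fun x => \int[mu]_(y in porous_cube x r) F y).
Proof.
move=> mF F0.
have mF2 : measurable_fun setT (F \o (@snd 'rV[R]_d 'rV[R]_d)).
  exact: measurableT_comp mF measurable_snd.
exact: (@measurable_integral_section _ _ _ mu _ _
  (measurable_porous_cube_pair r) mF2 (fun xy => F0 xy.2)).
Qed.

(** Here criticality acts: the [scale i ^ (k - d)] of the chain weight cancels the
    [scale i ^ (d - k)] of the fibre measure. Only [scale j ^ k] survives, to be cancelled by the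
    power of the distance in the Hardy weight. *)
Lemma layer_integral_le j :
  \int[mu]_(x in layer j) f x <=
  (scale j ^+ k)%:E * ((2 `^ q * j.+1%:R `^ q)%:E *
     ((2 * C / rho0 ^+ k)%:E * \int[mu]_(y in shell 0) f y +
      \sum_(i < j.+1) (chain_const * C * i.+1%:R `^ q)%:E *
         \int[mu]_(y in shell i) Gam y) +
     point_const%:E * \int[mu]_(y in layer j) Gam y).
Proof.
have cC0 : (0 <= chain_const * C)%R.
  by rewrite (mulr_ge0 chain_const_ge0)// ltW.
have mSi i : measurable_fun (layer j) (fun x =>
    (chain_weight i)%:E * \int[mu]_(y in porous_cube x (scale i)) Gam y).
  apply: measurable_funeM;
    apply: measurable_funS (measurable_porous_integral _ _ _) => //.
  by move=> y; exact: gdensity_ge0.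
have mfi : measurable_fun (layer j) (fun x =>
    (2 / rho0 ^+ d)%:E * \int[mu]_(y in porous_cube x (scale 0)) f y).
  by apply: measurable_funeM;
    apply: measurable_funS (measurable_porous_integral _ _ _).
have mS : measurable_fun (layer j) (chain_sum j).
  apply: emeasurable_funD => //.
  by apply: emeasurable_sum => i; exact: mSi.
have c0 : (0 <= 2 / rho0 ^+ d)%R.
  by rewrite divr_ge0// exprn_ge0// ltW.
have mGamj : measurable_fun (layer j) Gam by exact: measurable_funS mGam.
have intS : \int[mu]_(x in layer j) chain_sum j x <= (scale j ^+ k)%:E *
     ((2 * C / rho0 ^+ k)%:E * \int[mu]_(y in shell 0) f y +
      \sum_(i < j.+1) (chain_const * C * i.+1%:R `^ q)%:E *
         \int[mu]_(y in shell i) Gam y).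
  rewrite [leLHS]ge0_integralD; [|exact: measurable_layer| |exact: mfi| |];
    first last.
  - by apply: emeasurable_sum => i; exact: mSi.
  - by move=> x _; apply: sume_ge0 => i _;
    rewrite mule_ge0// lee_fin chain_weight_ge0.
  - by move=> x _; rewrite mule_ge0.
  rewrite ge0_muleDr; last 2 first.
  - rewrite mule_ge0// lee_fin divr_ge0 ?mulr_ge0 ?exprn_ge0// ltW//.
  - apply: sume_ge0 => i _; rewrite mule_ge0// lee_fin.
    by rewrite (mulr_ge0 cC0)// powR_ge0.
  apply: leeD.
    rewrite ge0_integralZl//; last 2 first.
    - exact: measurable_layer.
    - by apply: measurable_funS (measurable_porous_integral _ _ _).
    apply: le_trans.
      apply: lee_wpmul2l; first by rewrite lee_fin.
      exact: (layer_porous_integral_le (leq0n j) mf f_ge0).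
    rewrite !muleA -!EFinM lee_wpmul2r// lee_fin.
    rewrite [scale 0]/scale expr0 mulr1 -[in (rho0 ^+ d)%R](subnK kd) exprD.
    rewrite le_eqVlt; apply/orP; left; apply/eqP; field.
    by rewrite !gt_eqF ?exprn_gt0.
  rewrite ge0_integral_sum; [|exact: measurable_layer|exact: mSi|]; last first.
    by move=> i x _; rewrite mule_ge0// lee_fin chain_weight_ge0.
  rewrite ge0_sume_distrr; last first.
    move=> i _; rewrite mule_ge0// lee_fin.
    by rewrite (mulr_ge0 cC0)// powR_ge0.
  apply: lee_sum => i _.
  rewrite ge0_integralZl; [|exact: measurable_layer| | |]; first last.
  - by rewrite lee_fin chain_weight_ge0.
  - by move=> x _; exact: int_Gam_ge0.
  - apply: measurable_funS (measurable_porous_integral _ _ _) => //.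
    by move=> y; exact: gdensity_ge0.
  apply: le_trans.
    apply: lee_wpmul2l; first by rewrite lee_fin chain_weight_ge0.
    have ij : (i <= j)%N by rewrite -ltnS.
    apply: (layer_porous_integral_le ij mGam) => y; exact: gdensity_ge0.
  rewrite !muleA -!EFinM lee_wpmul2r// lee_fin /chain_weight.
  rewrite -[in (scale i ^+ d)%R](subnK kd) exprD.
  rewrite le_eqVlt; apply/orP; left; apply/eqP; field.
  by rewrite !gt_eqF ?exprn_gt0// scale_gt0.
have a0 : (0 <= 2 `^ q * j.+1%:R `^ q :> R)%R by rewrite mulr_ge0 ?powR_ge0.
have b0 : (0 <= point_const * scale j ^+ k)%R.
  by rewrite mulr_ge0 ?point_const_ge0// exprn_ge0// ltW// scale_gt0.
apply: (@le_trans _ _ (\int[mu]_(x in layer j)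
  ((2 `^ q * j.+1%:R `^ q)%:E * chain_sum j x +
         (point_const * scale j ^+ k)%:E * Gam x))).
  apply: ge0_le_integral.
  - exact: measurable_layer.
  - by move=> x _; exact: f_ge0.
  - exact: measurable_funS mf.
  - by apply: emeasurable_funD; exact: measurable_funeM.
  - by move=> x /andP[_ xj]; exact: chain_pointwise.
rewrite ge0_integralD; [|exact: measurable_layer| | | |]; first last.
- exact: measurable_funeM.
- by move=> x _; rewrite mule_ge0 ?gdensity_ge0// lee_fin.
- exact: measurable_funeM.
- by move=> x _; rewrite mule_ge0 ?chain_sum_ge0// lee_fin.
rewrite ge0_muleDr; last 2 first.
- rewrite mule_ge0 ?lee_fin//; apply: adde_ge0.
    by rewrite mule_ge0// lee_fin divr_ge0 ?mulr_ge0 ?exprn_ge0// ltW.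
  apply: sume_ge0 => i _; rewrite mule_ge0// lee_fin.
  by rewrite (mulr_ge0 cC0)// powR_ge0.
- by rewrite mule_ge0// lee_fin point_const_ge0.
apply: leeD.
  rewrite ge0_integralZl; [|exact: measurable_layer|exact: mS| |]; first last.
  - by rewrite lee_fin.
  - by move=> x _; exact: chain_sum_ge0.
  by rewrite muleCA lee_wpmul2l// lee_fin.
rewrite ge0_integralZl; [|exact: measurable_layer|exact: mGamj| |]; first last.
- by rewrite lee_fin.
- by move=> x _; exact: gdensity_ge0.
by rewrite muleA -EFinM mulrC.
Qed.

End porosity.

(** * The critical fractional Hardy inequality *)

Section disjoint_integrals.
Context d (T : measurableType d) (R : realType).
Variables (mu : {measure set T -> \bar R}) (F : (set T)^nat).
Hypotheses (mF : forall i, measurable (F i)) (tF : trivIset setT F).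
Local Open Scope ereal_scope.

Lemma sum_disjoint_integral_le (D : set T) (h : T -> \bar R) (n : nat) :
  measurable D -> (forall i, F i `<=` D) ->
  measurable_fun setT h -> (forall x, 0 <= h x) ->
  \sum_(i < n) \int[mu]_(x in F i) h x <= \int[mu]_(x in D) h x.
Proof.
move=> mD FD mh h0.
apply: (@le_trans _ _ (\int[mu]_(x in \bigcup_i F i) h x)).
  rewrite ge0_integral_bigcup//; last exact: measurable_funS mh.
  rewrite -(big_mkord xpredT (fun i => \int[mu]_(x in F i) h x)).
  apply: (nneseries_lim_ge (P := xpredT)) => i _ _; exact: integral_ge0.
apply: ge0_subset_integral => //; first exact: bigcup_measurable.
  exact: measurable_funS mh.
by move=> x [i _ /FD].
Qed.

Lemma integral_bigcup_le (h : T -> \bar R) (b : \bar R) :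
  measurable_fun setT h -> (forall x, 0 <= h x) ->
  (forall n, \sum_(i < n) \int[mu]_(x in F i) h x <= b) ->
  \int[mu]_(x in \bigcup_i F i) h x <= b.
Proof.
move=> mh h0 hb; rewrite ge0_integral_bigcup//; last exact: measurable_funS mh.
apply: lime_le; first by apply: is_cvg_nneseries => i _ _; exact: integral_ge0.
by apply: nearW => n; rewrite big_mkord.
Qed.

End disjoint_integrals.

Section layer_sum.
Context {R : realType}.

(** Sums the layer estimates against the logarithmic weight [j ^ (- p)], using
    [j ^ (- p) * j ^ q = j ^ (- 1 - q)]. [N] plays the L^p norm, [G] and [g] the energies on shells
    and layers. *)
Lemma layer_sum_le (p q c0 c1 c2 c3 N T : R) (G g : nat -> R) (n : nat) :
  0 < q -> p = 1 + 2 * q -> 0 <= c0 -> 0 <= c1 -> 0 <= c2 -> 0 <= c3 ->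
  0 <= N -> 0 <= T ->
  (forall i, 0 <= G i) -> (forall i, 0 <= g i) ->
  \sum_(i < n) G i <= T -> \sum_(i < n) g i <= T ->
  \sum_(j < n) j.+1%:R `^ (- p) *
    (c1 * j.+1%:R `^ q * (c3 * N + \sum_(i < j.+1) c2 * i.+1%:R `^ q * G i) +
     c0 * g j) <= (c1 * (2 / q + 1) * (c2 + c3) + c0) * (T + N).
Proof.
move=> q0 pq c00 c10 c20 c30 N0 T0 G0 g0 GT gT.
(* The coarsest average is treated as additional energy at index 0, so that one double-sum
   inequality handles both contributions. *)
pose G' i := c2 * G i + (if i == 0%N then c3 * N else 0).
have G'0 i : 0 <= G' i by rewrite addr_ge0 ?mulr_ge0//; case: ifP;
  rewrite ?mulr_ge0.
have S_E j : c3 * N + \sum_(i < j.+1) c2 * i.+1%:R `^ q * G i =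
    \sum_(i < j.+1) i.+1%:R `^ q * G' i.
  rewrite !big_ord_recl/= /G' powR1 !mul1r mulr1 eqxx addrA (addrC (c3 * N)).
  by congr +%R; apply: eq_bigr => i _; rewrite /bump/= addr0; ring.
have E1 (j : nat) :
    j.+1%:R `^ (- p) * j.+1%:R `^ q = j.+1%:R `^ (- 1 - q) :> R.
  rewrite -powRD; last by rewrite pnatr_eq0 implybT.
  by congr (_ `^ _); rewrite pq; ring.
rewrite (eq_bigr (fun j : 'I_n => c1 * (j.+1%:R `^ (- 1 - q) *
    (\sum_(i < j.+1) i.+1%:R `^ q * G' i)) + c0 * (j.+1%:R `^ (- p) * g j)));
    last first.
  by move=> j _; rewrite S_E -E1; ring.
rewrite big_split/= -!mulr_sumr.
have G'T : \sum_(i < n) G' i <= c2 * T + c3 * N.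
  rewrite big_split/= -mulr_sumr lerD ?ler_wpM2l//.
  case: (n) => [|m]; first by rewrite big_ord0 mulr_ge0.
  by rewrite big_ord_recl/= big1// addr0.
have gT' : \sum_(i < n) i.+1%:R `^ (- p) * g i <= T.
  apply: le_trans gT; apply: ler_sum => i _; rewrite ler_piMl//.
  rewrite powRN invf_le1 ?powR_gt0//.
  apply: (@le_trans _ _ (1 `^ p)); first by rewrite powR1.
  rewrite ge0_ler_powR ?nnegrE ?ler1n//.
  by rewrite pq addr_ge0// mulr_ge0// ltW.
have C0 : 0 <= 2 / q + 1 by rewrite addr_ge0// divr_ge0// ltW.
have := weighted_double_sum_le n q0 G'0.
move=> /(le_trans) /(_ (ler_wpM2l C0 G'T)) => dsum.
apply: (le_trans (lerD (ler_wpM2l c10 dsum) (ler_wpM2l c00 gT'))).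
rewrite [leRHS]mulrDl lerD//; last by rewrite ler_wpM2l// lerDl.
rewrite -!mulrA ler_wpM2l// ler_wpM2l//.
have := mulr_ge0 c20 N0; have := mulr_ge0 c30 T0; lra.
Qed.

End layer_sum.

Section weight.
Context {R : realType} {d : nat}.
Variables (K : set 'rV[R]_d).
Hypothesis (K0 : K !=set0).

Lemma log_weight_ge0 rho a b x : 0 <= log_weight rho a b K x.
Proof. by rewrite mulr_ge0 ?powR_ge0. Qed.

Lemma measurable_log_weight rho a b :
  measurable_fun setT (log_weight rho a b K).
Proof.
have mD := measurable_delta K0.
apply: measurable_funM.
  exact: (measurableT_comp (measurable_powR _) mD).
apply: (measurableT_comp (measurable_powR _)).
apply: (measurableT_comp (@measurable_ln R)).
apply: measurable_funM => //.
rewrite (_ : (fun _ => _) = (fun t => t `^ (- 1))%R \o delta K).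
  exact: (measurableT_comp (measurable_powR _) mD).
by apply/funext => x /=; rewrite powR_inv1// delta_ge0.
Qed.

Lemma log_weight_eq0 rho a b x : a != 0 -> delta K x = 0 ->
  log_weight rho a b K x = 0.
Proof. by move=> a0 Kx; rewrite /log_weight Kx powR0// mul0r. Qed.

(** [n] dyadic steps between [delta K x] and [rho] give [2 * rho / delta K x >= 2 ^ (n + 1)], so the
    logarithm is at least [(n + 1) * ln 2]. The shift by one keeps it positive at [n = 0]. *)
Lemma le_log_weight rho a b x t n : 0 <= a -> 0 <= b -> 0 < t ->
  t <= delta K x -> 2 ^+ n * delta K x <= rho ->
  t `^ a * (ln 2 `^ b * n.+1%:R `^ b) <= log_weight rho a b K x.
Proof.
move=> a0 b0 t0 tK Krho; have Kx0 := lt_le_trans t0 tK.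
apply: ler_pM; rewrite ?mulr_ge0 ?powR_ge0//.
  by rewrite ge0_ler_powR ?nnegrE// ltW.
have ln2 : 0 < ln 2 :> R by rewrite ln_gt0// ltr1n.
rewrite -powRM ?(ltW ln2)//.
have lnn : ln 2 * n.+1%:R <= ln (2 * rho / delta K x).
  rewrite mulr_natr -lnXn// ler_ln ?posrE ?exprn_gt0//.
    by rewrite exprS ler_pdivlMr// -mulrA ler_pM2l.
  by rewrite divr_gt0// mulr_gt0// (lt_le_trans _ Krho)// mulr_gt0.
by rewrite ge0_ler_powR ?nnegrE ?mulr_ge0 ?(ltW ln2)// (le_trans _ lnn)//
  mulr_ge0 ?ltW.
Qed.

End weight.
Section hardy.
Context {R : realType} {d : nat}.
Local Notation mu := (lebesgue_rV R d).
Local Open Scope ereal_scope.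

Lemma critical_log_hardy (Omega K : set 'rV[R]_d) (k : nat) (C r0 p rho : R) :
  open Omega -> compact K -> K !=set0 -> K `<=` Omega ->
  (0 < k <= d)%N -> (0 < C)%R -> (0 < r0)%R -> codim_regular k K C r0 ->
  (1 < p)%R -> (0 < rho)%R -> (forall x, Omega x -> delta K x < rho)%R ->
  exists2 CH : R, (0 < CH)%R & forall u : 'rV[R]_d -> R,
    measurable_fun setT u ->
    \int[mu]_(x in Omega) (`|u x| `^ p)%:E < +oo ->
    \int[mu]_(x in Omega) gdensity Omega p k u x < +oo ->
    \int[mu]_(x in Omega) (`|u x| `^ p / log_weight rho k%:R p K x)%:E <=
    CH%:E * (\int[mu]_(x in Omega) gdensity Omega p k u x +
             \int[mu]_(x in Omega) (`|u x| `^ p)%:E).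
Proof.
move=> oO cK K0 KO /andP[k0 kd] C0 r00 regK p1 rho_gt0 Krho.
have mO := open_measurable_rV oO.
have [e e0 eO] := compact_delta_open cK oO K0 KO.
pose b : R := (1 + d%:R)%R.
have b1 : (1 <= b)%R by rewrite lerDl.
have b0 : (0 < b)%R by exact: lt_le_trans b1.
(* Chosen so that [beta = b * lam = 1 / (2 (1 + C))], which gives porosity through
   [C * beta <= 1 / 2]; moreover [lam <= 1 / 2], so each scale is at least one dyadic step. *)
pose lam : R := (2 * b * (1 + C))^-1%R.
have C1 : (0 < 1 + C)%R by rewrite addr_gt0.
have lam0 : (0 < lam)%R by rewrite invr_gt0 !mulr_gt0.
have lam2 : (lam <= 2^-1)%R.
  rewrite lef_pV2 ?posrE ?mulr_gt0//.
  have : (1 * 1 <= b * (1 + C))%R by rewrite ler_pM// lerDl ltW.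
  by rewrite -mulrA; lra.
have lam1 : (lam <= 1)%R by rewrite (le_trans lam2)// invf_le1 ?ler1n.
pose beta : R := (b * lam)%R.
have betaE : (beta = (2 * (1 + C))^-1)%R.
  by rewrite /beta /lam; field; rewrite !gt_eqF.
have beta0 : (0 < beta)%R by rewrite mulr_gt0.
have beta1 : (beta <= 1)%R.
  by rewrite betaE invf_le1 ?mulr_gt0//; lra.
have Cbeta : (C * beta <= 2^-1)%R.
  rewrite betaE invfM mulrCA ler_piMr// ?invr_ge0//.
  by rewrite ler_pdivrMr// mul1r lerDr.
(* [r0] is the range of the regularity bound, [e / b] keeps the shells inside [Omega], and [rho]
   makes [2 ^ j * scale j <= rho]. *)
pose rho0 : R := (Num.min r0 (Num.min (e / b) rho))%R.
have rho00 : (0 < rho0)%R by rewrite !lt_min r00 divr_gt0// rho_gt0.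
have rho0r0 : (rho0 <= r0)%R by rewrite ge_min lexx.
have rho0e : (rho0 <= e / b)%R by rewrite !ge_min lexx orbT.
have rho0rho : (rho0 <= rho)%R by rewrite !ge_min lexx !orbT.
have collar x : (delta K x < (1 + d%:R) * rho0)%R -> Omega x.
  move=> xr; apply: eO; apply: (lt_le_trans xr).
  by rewrite mulrC -ler_pdivlMr.
pose q : R := ((p - 1) / 2)%R.
have q0 : (0 < q)%R by rewrite divr_gt0// subr_gt0.
have pq : (p = 1 + 2 * q)%R by rewrite /q; field.
have p0 : (0 < p)%R by exact: lt_trans p1.
pose sc := scale lam rho0.
pose lay := layer K lam rho0.
pose shl := shell K lam rho0.
have sc0 i : (0 < sc i)%R by exact: scale_gt0.
have k0R : (k%:R != 0 :> R)%R by rewrite pnatr_eq0 -lt0n.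
have ln2 : (0 < ln 2 :> R)%R by rewrite ln_gt0// ltr1n.
have ln2p : (0 < ln 2 `^ p :> R)%R by rewrite powR_gt0.
pose cfar : R := (rho0 ^+ k * ln 2 `^ p)^-1%R.
have cfar0 : (0 < cfar)%R by rewrite invr_gt0 mulr_gt0// exprn_gt0.
pose c4 : R := (lam ^+ k * ln 2 `^ p)^-1%R.
have c40 : (0 < c4)%R by rewrite invr_gt0 mulr_gt0// exprn_gt0.
pose c1 : R := (2 `^ q)%R.
pose c2 : R := (@chain_const R d k q lam * C)%R.
pose c3 : R := (2 * C / rho0 ^+ k)%R.
pose cp : R := @point_const R d k q.
have c10 : (0 <= c1)%R by rewrite powR_ge0.
have c20 : (0 <= c2)%R.
  by rewrite mulr_ge0 ?(ltW C0)// chain_const_ge0.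
have c30 : (0 <= c3)%R by rewrite divr_ge0 ?mulr_ge0 ?exprn_ge0// ltW.
have cp0 : (0 <= cp)%R by exact: point_const_ge0.
pose CL : R := (c4 * ((c1 * (2 / q + 1) * (c2 + c3) + cp)))%R.
have CL0 : (0 <= CL)%R.
  rewrite mulr_ge0 ?(ltW c40)// addr_ge0// !mulr_ge0 ?addr_ge0//.
  by rewrite divr_ge0// ltW.
exists (cfar + CL)%R; first by rewrite ltr_wpDr.
move=> u mu_u fin_f fin_G.
pose f x := (`|u x| `^ p)%:E; pose Gam := gdensity Omega p k u.
pose F x := (`|u x| `^ p / log_weight rho k%:R p K x)%:E.
have f0 x : 0 <= f x by rewrite lee_fin powR_ge0.
have G0 x : 0 <= Gam x by exact: gdensity_ge0.
have F0 x : 0 <= F x by rewrite lee_fin divr_ge0 ?powR_ge0 ?log_weight_ge0.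
have mf : measurable_fun setT f by exact: measurable_powR_norm.
have mG : measurable_fun setT Gam by exact: measurable_gdensity.
have mF : measurable_fun setT F.
  apply/measurable_EFinP; apply: measurable_funM.
    exact/measurable_EFinP.
  rewrite (_ : (fun _ => _) =
      (fun t => t `^ (- 1))%R \o log_weight rho k%:R p K).
    apply: (measurableT_comp (measurable_powR _)).
    exact: measurable_log_weight.
  by apply/funext => x /=; rewrite powR_inv1// log_weight_ge0.
have mlay i : measurable (lay i) by exact: measurable_layer.
have mshl i : measurable (shl i) by exact: measurable_shell.
have sc_le i j : (i <= j)%N -> (sc j <= sc i)%R by exact: le_scale.
have tlay : trivIset setT lay.
  apply/trivIsetP => i j _ _; wlog ij : i j / (i < j)%N.
    by move=> H; rewrite neq_ltn => /orP[ij|ij]; [|rewrite setIC];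
      apply: H => //; rewrite neq_ltn ij.
  move=> _; rewrite -subset0 => x [/andP[ix _] /andP[_ xj]].
  by have := lt_le_trans xj (le_trans (sc_le _ _ ij) ix); rewrite ltxx.
have tshl : trivIset setT shl.
  apply/trivIsetP => i j _ _; wlog ij : i j / (i < j)%N.
    by move=> H; rewrite neq_ltn => /orP[ij|ij]; [|rewrite setIC];
      apply: H => //; rewrite neq_ltn ij.
  move=> _; rewrite -subset0 => x [/andP[ix _] /andP[_ xj]].
  have : (b * sc j <= b * sc i.+1)%R by rewrite ler_pM2l// sc_le.
  by move=> /(lt_le_trans xj)/lt_le_trans/(_ ix); rewrite ltxx.
have shlO i : shl i `<=` Omega by exact: shell_Omega.
have layO i : lay i `<=` Omega.
  move=> x /andP[_ xi]; apply: collar; apply: (lt_le_trans xi).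
  apply: (@le_trans _ _ rho0); first exact: scale_le_rho0.
  by rewrite ler_peMl// ltW.
have fin_sub (h : 'rV[R]_d -> \bar R) E : measurable E -> E `<=` Omega ->
    measurable_fun setT h -> (forall x, 0 <= h x) ->
    \int[mu]_(x in Omega) h x < +oo ->
    \int[mu]_(x in E) h x <= \int[mu]_(x in Omega) h x /\
    \int[mu]_(x in E) h x \is a fin_num.
  move=> mE EO mh h0 hoo.
  have Ele : \int[mu]_(x in E) h x <= \int[mu]_(x in Omega) h x.
    by apply: ge0_subset_integral => //; exact: measurable_funS mh.
  by split=> //; rewrite ge0_fin_numE ?(le_lt_trans Ele)//; exact: integral_ge0.
(* All integrals involved are finite, so the summation over layers takes place in the reals. *)
pose N := fine (\int[mu]_(x in Omega) f x).
have NE : \int[mu]_(x in Omega) f x = N%:E.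
  by rewrite fineK// ge0_fin_numE//; exact: integral_ge0.
pose T := fine (\int[mu]_(x in Omega) Gam x).
have TE : \int[mu]_(x in Omega) Gam x = T%:E.
  by rewrite fineK// ge0_fin_numE//; exact: integral_ge0.
pose G i := fine (\int[mu]_(x in shl i) Gam x).
have GE i : \int[mu]_(x in shl i) Gam x = (G i)%:E.
  by rewrite fineK//; case: (fin_sub Gam (shl i)).
pose g i := fine (\int[mu]_(x in lay i) Gam x).
have gE i : \int[mu]_(x in lay i) Gam x = (g i)%:E.
  by rewrite fineK//; case: (fin_sub Gam (lay i)).
have N0 : (0 <= N)%R by rewrite fine_ge0//; exact: integral_ge0.
have T0 : (0 <= T)%R by rewrite fine_ge0//; exact: integral_ge0.
have G'0 i : (0 <= G i)%R by rewrite fine_ge0//; exact: integral_ge0.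
have g0 i : (0 <= g i)%R by rewrite fine_ge0//; exact: integral_ge0.
have GT n : (\sum_(i < n) G i <= T)%R.
  rewrite -lee_fin -TE -sumEFin (eq_bigr _ (fun (i : 'I_n) _ => esym (GE i))).
  exact: sum_disjoint_integral_le.
have gT n : (\sum_(i < n) g i <= T)%R.
  rewrite -lee_fin -TE -sumEFin (eq_bigr _ (fun (i : 'I_n) _ => esym (gE i))).
  exact: sum_disjoint_integral_le.
have layF j : \int[mu]_(x in lay j) F x <=
    (c4 * (j.+1%:R `^ (- p) * (c1 * j.+1%:R `^ q *
      (c3 * N + \sum_(i < j.+1) c2 * i.+1%:R `^ q * G i) + cp * g j)))%:E.
  have c5 : (0 <= c4 * ((sc j ^+ k)^-1 * j.+1%:R `^ (- p)))%R.
    rewrite mulr_ge0 ?(ltW c40)// mulr_ge0 ?powR_ge0// invr_ge0 exprn_ge0//.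
    exact: ltW.
  apply: (@le_trans _ _ ((c4 * ((sc j ^+ k)^-1 * j.+1%:R `^ (- p)))%:E *
      \int[mu]_(x in lay j) f x)).
    rewrite -ge0_integralZl//; last exact: measurable_funS mf.
    apply: ge0_le_integral => //.
    - exact: measurable_funS mF.
    - by apply: measurable_funeM; exact: measurable_funS mf.
    move=> x /andP[jx xj]; rewrite -EFinM lee_fin [leRHS]mulrC.
    rewrite ler_wpM2l ?powR_ge0//.
    have w_ge : (sc j.+1 `^ k%:R * (ln 2 `^ p * j.+1%:R `^ p) <=
        log_weight rho k%:R p K x)%R.
      apply: le_log_weight => //; first exact: ltW.
      apply: (@le_trans _ _ (2 ^+ j * sc j)%R).
        by rewrite ler_pM2l ?exprn_gt0// ltW.
      rewrite /sc /scale mulrCA -exprMn; apply: le_trans rho0rho.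
      rewrite ler_piMr ?(ltW rho00)// exprn_ile1 ?mulr_ge0 ?(ltW lam0)//.
      by rewrite -ler_pdivlMl// mulr1.
    have -> : (c4 * ((sc j ^+ k)^-1 * j.+1%:R `^ (- p)) =
        (sc j.+1 `^ k%:R * (ln 2 `^ p * j.+1%:R `^ p))^-1)%R.
      rewrite powR_mulrn ?(ltW (sc0 _))// /sc scaleS powRN /c4.
      move: (scale lam rho0 j) => S; rewrite exprMn.
      by rewrite !invfM; ring.
    rewrite lef_pV2 ?posrE//.
      by apply: lt_le_trans w_ge; rewrite !mulr_gt0 ?powR_gt0.
    by rewrite !mulr_gt0 ?powR_gt0.
  have := @layer_integral_le R d K k C r0 K0 k0 kd C0 regK beta beta0 beta1
    Cbeta Omega p q u mO q0 pq mu_u lam rho0 lam0 lam1 rho00 rho0r0 erefl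
    collar j.
  move=> /(lee_wpmul2l _)/le_trans; apply; first by rewrite lee_fin.
  rewrite -/lay -/shl -/sc -/Gam gE.
  under eq_bigr => i _ do rewrite GE -EFinM.
  rewrite sumEFin.
  have [f_le _] := fin_sub f (shl 0%N) (mshl 0%N) (shlO 0%N) mf f0 fin_f.
  apply: (@le_trans _ _ ((c4 * ((sc j ^+ k)^-1 * j.+1%:R `^ (- p)))%:E *
     ((sc j ^+ k)%:E * ((c1 * j.+1%:R `^ q)%:E * (c3%:E * N%:E +
        (\sum_(i < j.+1) c2 * i.+1%:R `^ q * G i)%:E) + cp%:E * (g j)%:E)))).
    rewrite lee_wpmul2l ?lee_fin// lee_wpmul2l ?lee_fin ?exprn_ge0 ?(ltW (sc0
      _))//.
    rewrite leeD2r// lee_wpmul2l ?lee_fin ?mulr_ge0 ?powR_ge0//.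
    by rewrite leeD2r// lee_wpmul2l ?lee_fin// -NE.
  rewrite -!(EFinM, EFinD) lee_fin le_eqVlt; apply/orP; left; apply/eqP.
  by field; rewrite gt_eqF// exprn_gt0.
have near_le : \int[mu]_(x in \bigcup_i lay i) F x <= (CL * (T + N))%:E.
  apply: integral_bigcup_le => // n.
  apply: le_trans; first by apply: lee_sum => i _; exact: layF.
  rewrite sumEFin lee_fin -mulr_sumr /CL -mulrA ler_pM2l//.
  exact: layer_sum_le.
pose L := \bigcup_i lay i.
have mL : measurable L by exact: bigcup_measurable.
have LO : L `<=` Omega by move=> x [i _ /layO].
have mOL : measurable (Omega `\` L) by exact: measurableD.
have OE : Omega = (Omega `\` L) `|` L.
  by apply/seteqP; split=> x; [have [Lx|Lx] := pselect (L x);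
    [right|left]|move=> [[]//|/LO]].
have far_le : \int[mu]_(x in Omega `\` L) F x <= (cfar * N)%:E.
  apply: (@le_trans _ _ (cfar%:E * \int[mu]_(x in Omega `\` L) f x)).
    rewrite -ge0_integralZl//; last 2 first.
      exact: measurable_funS mf.
      by rewrite lee_fin ltW.
    apply: ge0_le_integral => //.
    - exact: measurable_funS mF.
    - by apply: measurable_funeM; exact: measurable_funS mf.
    move=> x [Ox nLx]; rewrite -EFinM lee_fin [leRHS]mulrC.
    rewrite ler_wpM2l ?powR_ge0//.
    (* Points at distance 0 lie in no layer; the weight vanishes there and the quotient is 0 by
       convention. *)
    have [Kx0|Kx0] := eqVneq (delta K x) 0%R.
      by rewrite log_weight_eq0// invr0 ltW.
    have {}Kx0 : (0 < delta K x)%R by rewrite lt_neqAle eq_sym Kx0 delta_ge0.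
    have [xr|xr] := leP rho0 (delta K x).
      have w_ge : (rho0 `^ k%:R * (ln 2 `^ p * 1%:R `^ p) <=
          log_weight rho k%:R p K x)%R.
        apply: (@le_log_weight _ _ _ _ _ _ _ _ 0) => //; first exact: ltW.
        by rewrite expr0 mul1r ltW// Krho.
      rewrite /cfar; move: w_ge;
        rewrite powR1 mulr1 powR_mulrn ?(ltW rho00)// => w_ge.
      have r0p : (0 < rho0 ^+ k * ln 2 `^ p)%R by rewrite mulr_gt0// exprn_gt0.
      by rewrite lef_pV2 ?posrE// (lt_le_trans r0p).
    exfalso; apply: nLx.
    have ex : exists n, (sc n <= delta K x)%R.
      have rK : (0 < delta K x / rho0)%R by rewrite divr_gt0.
      have /cvgrPdist_lt/(_ _ rK)[n _ /(_ n (leqnn n))] : (lam ^+ n)%R @[n -->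
        \oo] --> (0%R : R).
        apply: cvg_expr; rewrite gtr0_norm//.
        by rewrite (le_lt_trans lam2)// invf_lt1// ltr1n.
      rewrite /= sub0r normrN gtr0_norm ?exprn_gt0// ltr_pdivlMr// => nK.
      by exists n; rewrite /sc /scale mulrC ltW.
    (* The smallest n with [scale n <= delta K x] is positive, since [delta K x < rho0 = scale 0];
       its predecessor indexes the layer of [x]. *)
    have := ex_minnP ex; case: ex_minnP => -[|m] mx mmin _.
      by have := le_lt_trans mx xr; rewrite /sc /scale expr0 mulr1 ltxx.
    exists m => //; rewrite /lay /layer/= mx/= ltNge; apply/negP => /mmin.
    by rewrite ltnn.
  have [f_le _] := fin_sub f (Omega `\` L) mOL (@subDsetl _ _ _) mf f0 fin_f.
  by rewrite EFinM lee_wpmul2l ?lee_fin ?(ltW cfar0)// -NE.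
rewrite {1}OE ge0_integral_setU;
  [|exact: mOL|exact: mL|exact: measurable_funS mF|by move=> x _; exact: F0|];
  last first.
  by apply/disj_setPS => x [[_ ?]].
rewrite -/F -/Gam -/f TE NE -!EFinD -EFinM.
apply: (le_trans (leeD far_le near_le));
  rewrite -EFinD lee_fin [leRHS]mulrDl lerD2r.
by rewrite ler_pM2l// lerDr.
Qed.

End hardy.

(** * Interpolation *)

Section hoelder_interpolation.
Context d (T : measurableType d) (R : realType) (mu : {measure set T -> \bar
  R}).
Local Open Scope ereal_scope.

Lemma hoelder_interpolation (D : set T) (X Y : T -> R) (t : R) :
  measurable D -> measurable_fun setT X -> measurable_fun setT Y ->
  (forall x, 0 <= X x)%R -> (forall x, 0 <= Y x)%R -> (0 < t < 1)%R ->
  \int[mu]_(x in D) (X x `^ t * Y x `^ (1 - t))%:E <=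
  (\int[mu]_(x in D) (X x)%:E) `^ t * (\int[mu]_(x in D) (Y x)%:E) `^ (1 - t).
Proof.
move=> mD mX mY X0 Y0 /andP[t0 t1].
have s0 : (0 < 1 - t)%R by rewrite subr_gt0.
(* Hoelder's inequality is applied on the whole space, so the domain enters through its
   indicator. *)
pose X' x := (X x * \1_D x)%R; pose Y' x := (Y x * \1_D x)%R.
have I01 x : (0 <= \1_D x :> R)%R by rewrite indicE.
have X'0 x : (0 <= X' x)%R by rewrite mulr_ge0.
have Y'0 x : (0 <= Y' x)%R by rewrite mulr_ge0.
have mX' : measurable_fun setT X' by apply: measurable_funM.
have mY' : measurable_fun setT Y' by apply: measurable_funM.
have intE (Z : T -> R) : \int[mu]_(x in D) (Z x)%:E =
    \int[mu]_x (Z x * \1_D x)%:E.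
  rewrite integral_mkcond; apply: eq_integral => x _; rewrite patchE indicE.
  by case: ifP; rewrite ?mulr1 ?mulr0.
have mpow (Z : T -> R) a : measurable_fun setT Z ->
    measurable_fun setT (fun x => Z x `^ a)%R.
  by move=> mZ; exact: (measurableT_comp (measurable_powR a) mZ).
have ti0 : (0 < t^-1)%R by rewrite invr_gt0.
have si0 : (0 < (1 - t)^-1)%R by rewrite invr_gt0.
have ts1 : (t^-1^-1 + (1 - t)^-1^-1 = 1)%R by rewrite !invrK addrC subrK.
have := @hoelder _ _ _ mu (fun x => X' x `^ t)%R
  (fun x => Y' x `^ (1 - t))%R t^-1 (1 - t)^-1 (mpow _ _ mX') (mpow _ _ mY')
  ti0 si0 ts1.
rewrite Lnorm1 !unlock /= !invrK.
have NE (Z : T -> R) a : (0 < a)%R -> (forall x, 0 <= Z x)%R ->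
    \int[mu]_x (`|Z x `^ a|%:E `^ a^-1) = \int[mu]_x (Z x)%:E.
  move=> a0 Z0; apply: eq_integral => x _;
    rewrite poweR_EFin ger0_norm ?powR_ge0//.
  by rewrite -powRrM mulfV ?gt_eqF// powRr1.
rewrite !NE// -!intE; apply: le_trans; rewrite intE.
apply: ge0_le_integral => //.
- by move=> x _; rewrite lee_fin !mulr_ge0 ?powR_ge0.
- apply/measurable_EFinP; apply: measurable_funM => //.
  by apply: measurable_funM; exact: mpow.
- apply/measurable_EFinP; apply: measurableT_comp => //.
  by apply: measurable_funM; exact: mpow.
move=> x _; rewrite lee_fin ger0_norm ?mulr_ge0 ?powR_ge0// /X' /Y' indicE.
case: (x \in D); rewrite ?mulr1// ?mulr0 mulr_ge0 ?powR_ge0//.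
Qed.

End hoelder_interpolation.

(** * Negligibility of the zero set of the distance *)

Section null_sets.
Context {R : realType} {d : nat}.
Local Notation mu := (lebesgue_rV R d).

(** Letting [r] tend to 0 in the regularity bound shows that every cube of radius [r0] meets the
    zero set in a null set. *)
Lemma codim_regular_null (K : set 'rV[R]_d) k (C r0 : R) :
  K !=set0 -> (0 < k)%N -> 0 < C -> 0 < r0 -> codim_regular k K C r0 ->
  mu [set x | delta K x = 0] = 0%E.
Proof.
move=> K0 k0 C0 r00 regK; set Z := [set x | _].
have mZ : measurable Z.
  have := measurable_delta K0 measurableT (measurable_set1 0).
  by rewrite setTI.
have Zcube y : (mu (Z `&` cube y r0) <= 0%:E)%E.
  apply/lee_addgt0Pr => e e0; rewrite add0e.
  pose a := C * r0 ^+ (d - k).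
  have a0 : 0 < a by rewrite mulr_gt0// exprn_gt0.
  pose r := Num.min r0 (Num.min 1 (e / a)).
  have r_gt0 : 0 < r by rewrite !lt_min r00 ltr01 divr_gt0.
  have rr0 : r <= r0 by rewrite ge_min lexx.
  have r1 : r <= 1 by rewrite !ge_min lexx orbT.
  have rea : r <= e / a by rewrite !ge_min lexx !orbT.
  apply: (@le_trans _ _ (mu (cube y r0 `&` [set x | delta K x < r]))).
    apply: le_measure; rewrite ?inE.
    - by apply: measurableI => //; exact: measurable_cube.
    - by apply: measurableI;
      [exact: measurable_cube|exact: measurable_delta_lt].
    - by move=> x [Zx yx]; split => //; rewrite /= Zx.
  apply: (le_trans (regK y r r0 r_gt0 rr0 (lexx _))).
  rewrite lee_fin -/a (@le_trans _ _ (a * r))//.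
    by rewrite ler_pM2l// -[leRHS]expr1 ler_wiXn2l// ltW.
  by rewrite mulrC -ler_pdivlMr.
(* In place of a countable cover: the integral over [Z] of the constant [mu (cube x r0)] has fibres
   of measure 0, hence vanishes (with [0 * +oo = 0]), and it equals [(2 * r0) ^ d * mu Z]. *)
have := @schur_le _ _ _ mu Z setT _ (cst 1%E) 0 mZ measurableT
  (measurable_cube_pair r0) (measurable_cst _).
rewrite mul0e => schur.
have {schur} : (\int[mu]_(x in Z) (cst ((2 * r0) ^+ d)%:E x) <= 0)%E.
  apply: le_trans (schur _ _ _ _) => //.
  - rewrite le_eqVlt; apply/orP; left; apply/eqP; apply: eq_integral => x _.
    transitivity (\int[mu]_(y in cube x r0) (cst 1%E y))%E => //.
    rewrite integral_cst; last exact: measurable_cube.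
    by rewrite mul1e; apply/esym; exact: (lebesgue_cube x (ltW r00)).
  - move=> y; apply: le_trans (Zcube y); apply: le_measure; rewrite ?inE.
    + by apply: measurableI => //;
      exact: measurable_section_snd (measurable_cube_pair r0).
    + by apply: measurableI => //; exact: measurable_cube.
    + by move=> x [Zx xy]; split => //; rewrite cubeC.
rewrite integral_cst// => Z0.
have c0 : 0 < (2 * r0) ^+ d by rewrite exprn_gt0// mulr_gt0.
have : (((2 * r0) ^+ d)^-1%:E * (((2 * r0) ^+ d)%:E * mu Z) <= 0)%E.
  by rewrite mule_ge0_le0// lee_fin invr_ge0 ltW.
rewrite muleA -EFinM mulVf ?gt_eqF// mul1e => Zle.
by apply/eqP; rewrite eq_le Zle/=.
Qed.

End null_sets.

(** * The critical Hardy inequality for surfaces and Sobolev functions *)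

Section sobolev_hardy.
Context {R : realType} {d : nat}.
Local Notation mu := (lebesgue_rV R d).
Local Open Scope ereal_scope.

Lemma gagliardo_powE (Omega : set 'rV[R]_d) (s p : R) (k : nat)
    (u v : 'rV[R]_d -> R) : (s * p)%R = k%:R -> {in Omega, u =1 v} ->
  gagliardo_pow Omega s p u = \int[mu]_(x in Omega) gdensity Omega p k v x.
Proof.
move=> sp uv; apply: eq_integral => x Ox; apply: eq_integral => y Oy.
by rewrite /gkernel/= sp -natrD !uv.
Qed.

Lemma sobolev_log_hardy (Omega K : set 'rV[R]_d) (k : nat) (s p rho : R) :
  open Omega -> C01_surface Omega k K -> K `<=` Omega -> (0 < k <= d)%N ->
  (1 < p)%R -> (s * p)%R = k%:R -> (0 < rho)%R ->
  (forall x, Omega x -> delta K x < rho)%R ->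
  exists2 C : R, (0 < C)%R & forall u : 'rV[R]_d -> R, W Omega s p u ->
    \int[mu]_(x in Omega) (`|u x| `^ p / log_weight rho k%:R p K x)%:E <=
    C%:E * (gagliardo_pow Omega s p u + Lp_pow Omega p u).
Proof.
move=> oO SK KO kd p1 sp rho0 Krho; have [cK K0 _] := SK.
have /andP[k0 kd'] := kd.
have [C [r0 [C0 r00 regK]]] := C01_surface_regular kd' SK.
have [CH CH0 hardy] :=
  critical_log_hardy oO cK K0 KO kd C0 r00 regK p1 rho0 Krho.
exists CH => // u [mu_u Lpu gu].
(* Extension by zero makes the function measurable on the whole space without changing any integral
   over [Omega]. *)
pose v := u \_ Omega.
have uv : {in Omega, u =1 v} by move=> x xO; rewrite /v patchE xO.
have mv : measurable_fun setT v.
  exact/(measurable_restrictT _ (open_measurable_rV oO)).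
have LE : Lp_pow Omega p u = \int[mu]_(x in Omega) (`|v x| `^ p)%:E.
  by apply: eq_integral => x xO; rewrite uv.
have IE : \int[mu]_(x in Omega) (`|u x| `^ p / log_weight rho k%:R p K x)%:E =
    \int[mu]_(x in Omega) (`|v x| `^ p / log_weight rho k%:R p K x)%:E.
  by apply: eq_integral => x xO; rewrite uv.
move: gu Lpu; rewrite (gagliardo_powE sp uv) LE IE => gu Lpu.
exact: hardy.
Qed.

End sobolev_hardy.

(** * Global comparison of the three weights *)

Section weights.
Context {R : realType} {d : nat}.
Implicit Types (K : set 'rV[R]_d).

Lemma log_weight_powR rho a b t K x :
  log_weight rho (t * a) (t * b) K x = log_weight rho a b K x `^ t.
Proof.
by rewrite /log_weight powRM ?powR_ge0// -!powRrM [a * t]mulrC [b * t]mulrC.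
Qed.

Lemma log_weight_gt0 rho a b K x : 0 < delta K x -> delta K x < 2 * rho ->
  0 < log_weight rho a b K x.
Proof.
move=> K0 Krho; rewrite mulr_gt0 ?powR_gt0// ln_gt0// ltr_pdivlMr// mul1r.
exact: Krho.
Qed.

(* The comparison near [K1 `|` K2] extends to all of [Omega]: away from a
   neighbourhood all the distances are bounded below. *)
Lemma log_weight_lower_bound (Omega U K K1 K2 : set 'rV[R]_d)
    (rho a1 a2 p t r c : R) :
  K !=set0 -> K `<=` K1 `|` K2 ->
  compact K1 -> compact K2 -> K1 !=set0 -> K2 !=set0 ->
  open U -> K1 `|` K2 `<=` U -> 0 <= p ->
  0 <= a1 -> 0 <= a2 -> 0 < t < 1 -> 0 < rho -> r < 2 * rho -> 0 < c ->
  (forall x, Omega x -> delta K1 x < rho) ->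
  (forall x, Omega x -> delta K2 x < rho) ->
  (forall x, Omega x -> delta K x <= r) ->
  (forall x, U x ->
     c * (log_weight rho (t * a1) (t * p) K1 x *
          log_weight rho ((1 - t) * a2) ((1 - t) * p) K2 x)
     <= log_weight rho (t * a1 + (1 - t) * a2) p K x) ->
  exists2 c' : R, 0 < c' & forall x, Omega x ->
    c' * (log_weight rho a1 p K1 x `^ t * log_weight rho a2 p K2 x `^ (1 - t))
    <= log_weight rho (t * a1 + (1 - t) * a2) p K x.
Proof.
move=> K0 KK cK1 cK2 K10 K20 oU KU p0 a10 a20 /andP[t0 t1] rho0 rr c0
  K1rho K2rho Kr Ulow.
have s0 : 0 < 1 - t by rewrite subr_gt0.
have [e1 e10 eU1] := compact_delta_open cK1 oU K10 (subset_trans (@subsetUl _ _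
  _) KU).
have [e2 e20 eU2] := compact_delta_open cK2 oU K20 (subset_trans (@subsetUr _ _
  _) KU).
(* Outside [U] both distances are at least [e], hence so is [delta K], because [K] lies in the
   union. The maximum [r'] of [r] and [e] is positive and still below [2 * rho]. *)
pose e := Num.min (Num.min e1 e2) rho.
have e0 : 0 < e by rewrite !lt_min e10 e20.
have ee1 : e <= e1 by rewrite !ge_min lexx.
have ee2 : e <= e2 by rewrite !ge_min lexx orbT.
have erho : e <= rho by rewrite ge_min lexx orbT.
pose r' := Num.max r e.
have r'0 : 0 < r' by rewrite lt_max e0 orbT.
have r'rho : r' < 2 * rho.
  by rewrite gt_max rr (le_lt_trans erho)//; lra.
pose a := t * a1 + (1 - t) * a2.
have a_ge0 : 0 <= a by rewrite addr_ge0 ?mulr_ge0// ltW.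
pose m := e `^ a * ln (2 * rho / r') `^ p.
have lnr' : 0 < ln (2 * rho / r').
  by rewrite ln_gt0// ltr_pdivlMr// mul1r.
have m0 : 0 < m by rewrite mulr_gt0 ?powR_gt0.
pose M b := rho `^ b * ln (2 * rho / e) `^ p.
have MM A b x : 0 <= b -> e <= delta A x -> delta A x < rho ->
    log_weight rho b p A x <= M b.
  move=> b0 eA Arho; have A0 := lt_le_trans e0 eA.
  have lnA : 0 <= ln (2 * rho / delta A x).
    by rewrite ln_ge0// ler_pdivlMr// mul1r (le_trans (ltW Arho))//; lra.
  apply: ler_pM; rewrite ?powR_ge0//.
    by rewrite ge0_ler_powR ?nnegrE ?delta_ge0 ?(ltW rho0) ?(ltW Arho).
  have lnAe : ln (2 * rho / delta A x) <= ln (2 * rho / e).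
    by rewrite ler_ln ?posrE ?divr_gt0 ?mulr_gt0// ler_pM2l ?mulr_gt0// lef_pV2.
  by rewrite ge0_ler_powR ?nnegrE// (le_trans lnA).
have MM0 b : 0 <= M b by apply: mulr_ge0; exact: powR_ge0.
pose MMt := M a1 `^ t * M a2 `^ (1 - t).
have MMt0 : 0 <= MMt by rewrite mulr_ge0 ?powR_ge0.
have MMt1 : 0 < MMt + 1 by rewrite ltr_wpDl.
exists (Num.min c (m / (MMt + 1))); first by rewrite lt_min c0 divr_gt0.
move=> x Ox; have [Ux|nUx] := pselect (U x).
  apply: le_trans (Ulow x Ux); rewrite !log_weight_powR.
  by rewrite ler_wpM2r ?mulr_ge0 ?powR_ge0// ge_min lexx.
have e1K : e <= delta K1 x.
  by rewrite (le_trans ee1)// leNgt; apply/negP => /eU1.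
have e2K : e <= delta K2 x.
  by rewrite (le_trans ee2)// leNgt; apply/negP => /eU2.
have eK : e <= delta K x.
  apply: le_delta => // y /KK[] Ky.
    exact: le_trans e1K (delta_le x Ky).
  exact: le_trans e2K (delta_le x Ky).
have W1 : log_weight rho a1 p K1 x `^ t <= M a1 `^ t.
  apply: ge0_ler_powR; rewrite ?(ltW t0) ?nnegrE ?log_weight_ge0 ?MM0//.
  exact: MM (K1rho x Ox).
have W2 : log_weight rho a2 p K2 x `^ (1 - t) <= M a2 `^ (1 - t).
  apply: ge0_ler_powR; rewrite ?(ltW s0) ?nnegrE ?log_weight_ge0 ?MM0//.
  exact: MM (K2rho x Ox).
have W12 : log_weight rho a1 p K1 x `^ t * log_weight rho a2 p K2 x `^ (1 - t)
    <= MMt + 1.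
  apply: (@le_trans _ _ MMt); last by rewrite lerDl.
  by apply: ler_pM W1 W2; exact: powR_ge0.
apply: (@le_trans _ _ (m / (MMt + 1) * (MMt + 1))).
  apply: ler_pM W12.
  - by rewrite le_min (ltW c0) divr_ge0// ltW.
  - by apply: mulr_ge0; exact: powR_ge0.
  - by rewrite ge_min lexx orbT.
rewrite divfK ?gt_eqF//.
have Kx0 := lt_le_trans e0 eK.
have Kr' : delta K x <= r' by rewrite le_max Kr.
apply: ler_pM; rewrite ?powR_ge0//.
  by rewrite ge0_ler_powR ?nnegrE ?(ltW e0) ?delta_ge0.
have lnle : ln (2 * rho / r') <= ln (2 * rho / delta K x).
  by rewrite ler_ln ?posrE ?divr_gt0 ?mulr_gt0// ler_pM2l ?mulr_gt0// lef_pV2.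
by rewrite ge0_ler_powR ?nnegrE ?(ltW lnr')// (le_trans (ltW lnr')).
Qed.

End weights.

Section interpolation_identities.
Context {R : realType}.
Implicit Types (a b c f t : R).

Lemma ler_div_scale f c a w : 0 <= f -> 0 < c * a -> c * a <= w ->
  f / w <= c^-1 * (f / a).
Proof.
move=> f0 ca0 caw; rewrite mulrCA -invfM ler_wpM2l// lef_pV2 ?posrE//.
exact: lt_le_trans ca0 caw.
Qed.

Lemma powR_interp_div f a b t : 0 <= f -> 0 <= a -> 0 <= b ->
  (f / a) `^ t * (f / b) `^ (1 - t) = f / (a `^ t * b `^ (1 - t)).
Proof.
move=> f0 a0 b0; rewrite !powRM ?invr_ge0// !powRV// invfM mulrACA -powRD.
  by rewrite addrC subrK powRr1.
by rewrite addrC subrK oner_eq0.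
Qed.

Lemma powR_interp_scale c a b x y t r :
  0 <= c -> 0 <= a -> 0 <= b -> 0 <= x -> 0 <= y ->
  (c * ((a * x) `^ t * (b * y) `^ (1 - t))) `^ r =
  (c * (a `^ t * b `^ (1 - t))) `^ r * ((x `^ r) `^ t * (y `^ r) `^ (1 - t)) :>
    R.
Proof.
move=> c0 a0 b0 x0 y0; rewrite (powRAC x) (powRAC y).
rewrite (@powRM _ a x t a0 x0) (@powRM _ b y (1 - t) b0 y0).
have A0 := powR_ge0 a t; have B0 := powR_ge0 b (1 - t).
have X0 := powR_ge0 x t; have Y0 := powR_ge0 y (1 - t).
move: (a `^ t) (b `^ _) (x `^ t) (y `^ _) A0 B0 X0 Y0 => A B X Y A0 B0 X0 Y0.
have -> : c * (A * X * (B * Y)) = c * (A * B) * (X * Y) by ring.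
by rewrite powRM ?mulr_ge0// (@powRM _ X Y r X0 Y0).
Qed.

Lemma poweR_interp_scale c a b x y t r :
  0 <= c -> 0 <= a -> 0 <= b -> 0 <= x -> 0 <= y ->
  ((c * ((a * x) `^ t * (b * y) `^ (1 - t))) `^ r)%:E =
  (((c * (a `^ t * b `^ (1 - t))) `^ r)%:E *
   ((x `^ r)%:E `^ t * (y `^ r)%:E `^ (1 - t)))%E.
Proof.
by move=> *; rewrite powR_interp_scale// !poweR_EFin -!EFinM.
Qed.

End interpolation_identities.

(* [rho] is the R of the logarithms. The hypothesis [exists2 r, r < 2 * rho & _]
   makes ln (2 rho / delta_K) positive and bounded away from 0 on [Omega]; it
   does not follow from the bound on delta_K1 and delta_K2. *)
Theorem corollary1p2 (R : realType) (d : nat) (p : R)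
  (Omega K K1 K2 : set 'rV[R]_d) (k1 k2 : nat)
  (s s1 s2 theta gamma rho c : R) :
  1 < p -> (2 <= d)%N ->
  bounded_lipschitz_domain Omega ->
  K `<=` K1 `|` K2 -> K1 `|` K2 `<=` Omega ->
  C01_surface Omega k1 K1 -> C01_surface Omega k2 K2 ->
  (k1 < k2)%N ->
  (2 <= k1 <= d.-1)%N -> (2 <= k2 <= d.-1)%N ->
  0 < s < 1 -> 0 < theta < 1 -> 0 < s1 < 1 -> 0 < s2 < 1 ->
  s * p = gamma ->
  gamma = theta * k1%:R + (1 - theta) * k2%:R ->
  s = theta * s1 + (1 - theta) * s2 ->
  s1 * p = k1%:R -> s2 * p = k2%:R ->
  0 < rho ->
  (forall x, Omega x -> Num.max (delta K1 x) (delta K2 x) < rho) ->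
  (exists2 r : R, r < 2 * rho & forall x, Omega x -> delta K x <= r) ->
  0 < c ->
  (exists U : set 'rV[R]_d, [/\ open U, K1 `|` K2 `<=` U &
     forall x, U x ->
       c * (log_weight rho (theta * k1%:R) (theta * p) K1 x *
            log_weight rho ((1 - theta) * k2%:R) ((1 - theta) * p) K2 x)
       <= log_weight rho gamma p K x]) ->
  exists2 C : R, 0 < C &
    forall u : 'rV[R]_d -> R,
      (W0 Omega K1 s1 p `&` W0 Omega K2 s2 p) u ->
      ((\int[lebesgue_rV R d]_(x in Omega)
          (`|u x| `^ p / log_weight rho gamma p K x)%:E) `^ p^-1
       <= C%:E * (W_norm Omega s1 p u `^ theta *
                  W_norm Omega s2 p u `^ (1 - theta)))%E.
Proof.
move=> p1 d2 [_ oO _ _ _] KK KO S1 S2 k12 /andP[k1_2 k1d] /andP[k2_2 k2d] _ t01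
  _ _ _ gammaE _ sp1 sp2 rho0 Krho [r rr Kr] c0 [U [oU KU Ulow]].
have p0 : 0 < p by exact: lt_trans p1.
have /andP[t0 t1] := t01.
have s0 : 0 < 1 - theta by rewrite subr_gt0.
have k1d' : (0 < k1 <= d)%N by rewrite (ltn_trans _ k1_2)//= (leq_trans k1d)//
  leq_pred.
have k2d' : (0 < k2 <= d)%N by rewrite (ltn_trans _ k2_2)//= (leq_trans k2d)//
  leq_pred.
have k1R : 0 < k1%:R :> R by rewrite ltr0n; case/andP: k1d'.
have k2R : 0 < k2%:R :> R by rewrite ltr0n; case/andP: k2d'.
have gamma0 : 0 < gamma by rewrite gammaE addr_gt0// mulr_gt0.
(* For empty [K] the infimum gives [delta K = 0], so the weight is 0, the quotient is 0 by
   convention and the left-hand side vanishes. *)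
have [->|/set0P K0] := eqVneq K set0.
  exists 1 => // u _; rewrite integral0_eq ?poweR0r ?invr_neq0 ?gt_eqF//.
    by rewrite !mule_ge0// poweR_ge0.
  move=> x _; rewrite /log_weight /delta image_set0 inf0 powR0 ?gt_eqF//.
  by rewrite mul0r invr0 mulr0.
have K1O := subset_trans (@subsetUl _ _ _) KO.
have K2O := subset_trans (@subsetUr _ _ _) KO.
have K1rho x : Omega x -> delta K1 x < rho by move=> /Krho;
  rewrite gt_max => /andP[].
have K2rho x : Omega x -> delta K2 x < rho by move=> /Krho;
  rewrite gt_max => /andP[].
have [C1 C10 hardy1] := sobolev_log_hardy oO S1 K1O k1d' p1 sp1 rho0 K1rho.
have [C2 C20 hardy2] := sobolev_log_hardy oO S2 K2O k2d' p1 sp2 rho0 K2rho.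
have [cK1 K10 _] := S1; have [cK2 K20 _] := S2.
have null k A : (0 < k <= d)%N -> C01_surface Omega k A -> A !=set0 ->
    lebesgue_rV R d [set x | delta A x = 0] = 0%E.
  move=> /andP[kgt0 kd] SA A0.
  have [C [r0 [C0 r00 regA]]] := C01_surface_regular kd SA.
  exact: codim_regular_null A0 kgt0 C0 r00 regA.
pose w1 := log_weight rho k1%:R p K1; pose w2 := log_weight rho k2%:R p K2.
have [c' c'0 low] : exists2 c' : R, 0 < c' & forall x, Omega x ->
    c' * (w1 x `^ theta * w2 x `^ (1 - theta)) <= log_weight rho gamma p K x.
  rewrite gammaE; apply: (@log_weight_lower_bound _ _ Omega U K K1 K2 rho
    k1%:R k2%:R p theta r c) => //; first exact: ltW.
  by rewrite -gammaE.
exists ((c'^-1 * (C1 `^ theta * C2 `^ (1 - theta))) `^ p^-1).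
  by rewrite powR_gt0// mulr_gt0 ?invr_gt0// mulr_gt0// powR_gt0.
move=> u [[Wu1 _] [Wu2 _]].
have mO := open_measurable_rV oO.
have [mu_u Lpu gu1] := Wu1; have [_ _ gu2] := Wu2.
pose v := u \_ Omega.
have uv : {in Omega, u =1 v} by move=> x xO; rewrite /v patchE xO.
have mv : measurable_fun setT v by exact/(measurable_restrictT _ mO).
have mvp : measurable_fun setT (fun x => `|v x| `^ p).
  by apply: (measurableT_comp (measurable_powR p)); exact: measurableT_comp mv.
have mdiv a A : A !=set0 -> measurable_fun setT
    (fun x => `|v x| `^ p / log_weight rho a p A x).
  move=> A0; apply: measurable_funM => //.
  rewrite (_ : (fun _ => _) =
      (fun t => t `^ (- 1))%R \o log_weight rho a p A).
    apply: (measurableT_comp (measurable_powR _)).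
    exact: measurable_log_weight.
  by apply/funext => x /=; rewrite powR_inv1// log_weight_ge0.
pose X x := `|v x| `^ p / w1 x; pose Y x := `|v x| `^ p / w2 x.
have X0 x : 0 <= X x by rewrite divr_ge0 ?powR_ge0 ?log_weight_ge0.
have Y0 x : 0 <= Y x by rewrite divr_ge0 ?powR_ge0 ?log_weight_ge0.
have mX : measurable_fun setT X by exact: mdiv.
have mY : measurable_fun setT Y by exact: mdiv.
have divE a A : (\int[lebesgue_rV R d]_(x in Omega)
      (`|u x| `^ p / log_weight rho a p A x)%:E =
    \int[lebesgue_rV R d]_(x in Omega)
      (`|v x| `^ p / log_weight rho a p A x)%:E)%E.
  by apply: eq_integral => x xO; rewrite uv.
pose P1 := fine (gagliardo_pow Omega s1 p u + Lp_pow Omega p u).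
pose P2 := fine (gagliardo_pow Omega s2 p u + Lp_pow Omega p u).
have Lp0 : (0 <= Lp_pow Omega p u)%E.
  by apply: integral_ge0 => x _; rewrite lee_fin powR_ge0.
have gag0 sg : (0 <= gagliardo_pow Omega sg p u)%E.
  apply: integral_ge0 => x _; apply: integral_ge0 => y _.
  by rewrite lee_fin divr_ge0 ?powR_ge0.
have addE (a b : \bar R) : (0 <= a -> 0 <= b -> a < +oo -> b < +oo ->
    a + b = (fine (a + b))%:E)%E.
  move=> a0 b0 aoo boo; rewrite fineK// ge0_fin_numE; last exact: adde_ge0.
  exact: lte_add_pinfty.
have P1E := addE _ _ (gag0 s1) Lp0 gu1 Lpu; rewrite -/P1 in P1E.
have P2E := addE _ _ (gag0 s2) Lp0 gu2 Lpu; rewrite -/P2 in P2E.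
have P10 : 0 <= P1 by apply: fine_ge0; exact: adde_ge0.
have P20 : 0 <= P2 by apply: fine_ge0; exact: adde_ge0.
have intX : (\int[lebesgue_rV R d]_(x in Omega) (X x)%:E <= (C1 * P1)%:E)%E.
  by rewrite EFinM -P1E -divE; exact: hardy1.
have intY : (\int[lebesgue_rV R d]_(x in Omega) (Y x)%:E <= (C2 * P2)%:E)%E.
  by rewrite EFinM -P2E -divE; exact: hardy2.
(* Where [w1] or [w2] vanishes the product of quotients reads 0, while the integrand for [K] may be
   positive. *)
pose Z := [set x | delta K1 x = 0] `|` [set x | delta K2 x = 0].
have mZ_ A : A !=set0 -> measurable [set x : 'rV[R]_d | delta A x = 0].
  move=> A0; have := measurable_delta A0 measurableT (measurable_set1 0).
  by rewrite setTI.
have mZ : measurable Z by apply: measurableU; exact: mZ_.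
have Z0 : lebesgue_rV R d Z = 0%E.
  apply/eqP; rewrite -measure_le0.
  apply: (le_trans (measureU2 _ (mZ_ _ K10) (mZ_ _ K20))).
  rewrite le_eqVlt; apply/orP; left; apply/eqP; rewrite -[RHS]adde0.
  by congr (_ + _)%E; [exact: null k1d' S1 K10|exact: null k2d' S2 K20].
pose h x := (X x `^ theta * Y x `^ (1 - theta))%:E.
have mh : measurable_fun setT h.
  apply/measurable_EFinP; apply: measurable_funM.
    exact: (measurableT_comp (measurable_powR _) mX).
  exact: (measurableT_comp (measurable_powR _) mY).
have h0 x : (0 <= h x)%E by rewrite lee_fin mulr_ge0 ?powR_ge0.
have mono (a : \bar R) (b t : R) : (0 <= a -> a <= b%:E ->
    (0 <= t)%R -> a `^ t <= (b `^ t)%:E)%E.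
  move=> a0 ab t_0; rewrite -poweR_EFin; apply: gt0_ler_poweR => //.
    by rewrite in_itv/= a0 leey.
  by rewrite in_itv/= leey (le_trans a0 ab).
have int_h : (\int[lebesgue_rV R d]_(x in Omega) h x <=
    ((C1 * P1) `^ theta * (C2 * P2) `^ (1 - theta))%:E)%E.
  apply: le_trans.
    exact: (hoelder_interpolation (lebesgue_rV R d) mO mX mY X0 Y0 t01).
  rewrite EFinM; apply: lee_pmul (mono _ _ _ _ intX _) (mono _ _ _ _ intY _).
  - exact: poweR_ge0.
  - exact: poweR_ge0.
  - by apply: integral_ge0 => x _; exact: X0.
  - exact: ltW.
  - by apply: integral_ge0 => x _; exact: Y0.
  - exact: ltW.
have wK : (\int[lebesgue_rV R d]_(x in Omega)
    (`|u x| `^ p / log_weight rho gamma p K x)%:E <=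
    (c'^-1)%:E * \int[lebesgue_rV R d]_(x in Omega) h x)%E.
  have mF : measurable_fun setT (fun x => (`|v x| `^ p / log_weight rho gamma p
    K x)%:E).
    by apply/measurable_EFinP; exact: mdiv.
  have mOZ : measurable (Omega `\` Z) by exact: measurableD.
  have cV0 : (0 <= (c'^-1)%:E)%E by rewrite lee_fin invr_ge0 ltW.
  have mhO D : measurable D -> measurable_fun D h.
    by move=> mD; exact: measurable_funS mh.
  rewrite divE -(ge0_integralZl _ mO (mhO _ mO) (fun x _ => h0 x) cV0).
  have F0 x : Omega x -> (0 <= (`|v x| `^ p / log_weight rho gamma p K x)%:E)%E.
    by rewrite lee_fin divr_ge0 ?powR_ge0 ?log_weight_ge0.
  rewrite (ge0_negligible_integral mZ mO (measurable_funS measurableT _ mF) F0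
    Z0)//.
  apply: (@le_trans _ _ (\int[lebesgue_rV R d]_(x in Omega `\` Z)
      ((c'^-1)%:E * h x))%E); last first.
    apply: ge0_subset_integral => //.
    - by apply: measurable_funeM; exact: mhO.
    - by move=> x _; exact: mule_ge0.
  apply: ge0_le_integral => //.
  - by move=> x _; rewrite lee_fin divr_ge0 ?powR_ge0 ?log_weight_ge0.
  - exact: measurable_funS mF.
  - by apply: measurable_funeM; exact: mhO.
  move=> x [Ox nZx]; rewrite -EFinM lee_fin.
  have d1 : 0 < delta K1 x.
    by rewrite lt_neqAle delta_ge0 andbT eq_sym; apply/eqP => ?; apply: nZx;
      left.
  have d2' : 0 < delta K2 x.
    by rewrite lt_neqAle delta_ge0 andbT eq_sym; apply/eqP => ?; apply: nZx;
      right.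
  have rho2 : rho < 2 * rho by rewrite ltr_pMl// ltr1n.
  have w10 : 0 < w1 x by apply: log_weight_gt0 => //;
    exact: lt_trans (K1rho x Ox) rho2.
  have w20 : 0 < w2 x by apply: log_weight_gt0 => //;
    exact: lt_trans (K2rho x Ox) rho2.
  set f := `|v x| `^ p.
  have f0 : 0 <= f by exact: powR_ge0.
  have -> : X x `^ theta * Y x `^ (1 - theta) =
      f / (w1 x `^ theta * w2 x `^ (1 - theta)).
    exact: powR_interp_div f0 (ltW w10) (ltW w20).
  have W0 : 0 < w1 x `^ theta * w2 x `^ (1 - theta) by rewrite mulr_gt0//
    powR_gt0.
  have lowx := low x Ox.
  have cW0 : 0 < c' * (w1 x `^ theta * w2 x `^ (1 - theta)) by rewrite mulr_gt0.
  exact: ler_div_scale f0 cW0 lowx.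
have int0 : (0 <= \int[lebesgue_rV R d]_(x in Omega)
    (`|u x| `^ p / log_weight rho gamma p K x)%:E)%E.
  by apply: integral_ge0 => x _;
    rewrite lee_fin divr_ge0 ?powR_ge0 ?log_weight_ge0.
(* [P1] and [P2] are p-th powers of the norms; the root [1 / p] applied to [Q] separates the
   constant from the interpolated product of norms. *)
pose Q := c'^-1 * ((C1 * P1) `^ theta * (C2 * P2) `^ (1 - theta)).
have Q0 : 0 <= Q by rewrite mulr_ge0 ?invr_ge0 ?(ltW c'0)// mulr_ge0 ?powR_ge0.
have intQ : (\int[lebesgue_rV R d]_(x in Omega)
    (`|u x| `^ p / log_weight rho gamma p K x)%:E <= Q%:E)%E.
  apply: (le_trans wK); rewrite /Q EFinM lee_wpmul2l// lee_fin invr_ge0 ltW//.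
have pV0 : 0 <= p^-1 by rewrite invr_ge0 ltW.
apply: (le_trans (mono _ _ _ int0 intQ pV0)).
have N1E : W_norm Omega s1 p u = (P1 `^ p^-1)%:E.
  by rewrite /W_norm P1E; exact: poweR_EFin.
have N2E : W_norm Omega s2 p u = (P2 `^ p^-1)%:E.
  by rewrite /W_norm P2E; exact: poweR_EFin.
rewrite N1E N2E -poweR_interp_scale//; first by rewrite invr_ge0 ltW.
  exact: ltW.
exact: ltW.
Qed.
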